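(* Let $d\ge3$ and $G=T_d\Box\mathbb{Z}$, with critical probability $p_c$. Then $$\alpha(p_c)\le \mathrm{gr}(G)^{-1}=\frac{1}{d-1}.$$
   Context: $T_d$ is the $d$-regular tree with a fixed root (origin), and $T_d\Box\mathbb{Z}$ is its Cartesian product with the line $\mathbb{Z}$; vertices are pairs $(x,k)$ with $x\in T_d$, $k\in\mathbb{Z}$, and $o=(\text{root},0)$. In Bernoulli bond percolation with parameter $p\in[0,1]$ each edge is independently open with probability $p$ and closed otherwise; $\mathbb{P}_p$ is the associated probability measure. Clusters are the connected components of the subgraph of open edges. $p_c=\inf\{p\in[0,1]: \text{there exists an infinite cluster almost surely}\}$. For vertices $x,y$, $(x\leftrightarrow y)$ is the event that there is an open path between $x$ and $y$. Define $$\alpha(p)=\lim_{n\to\infty}\mathbb{P}_p(o\leftrightarrow(v_n,0))^{1/n}=\sup_{n\ge1}\mathbb{P}_p(o\leftrightarrow(v_n,0))^{1/n},$$ where $v_n$ is any vertex of $T_d$ at distance $n$ from the root (the value does not depend on the choice; the limit exists and equals the supremum by supermultiplicativity). The growth rate is $\mathrm{gr}(G)=\liminf_{r\to\infty}|B(x,r)|^{1/r}$, where $B(x,r)$ is the ball of radius $r$ around a vertex $x$ of $G$ in the graph distance. *)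

(* Defs.v *)
From HB Require Import structures.
From mathcomp Require Import all_boot all_order all_algebra finmap.
From mathcomp Require Import all_classical all_reals all_analysis.

Set Implicit Arguments.
Unset Strict Implicit.
Unset Printing Implicit Defensive.

Import Order.TTheory GRing.Theory Num.Theory.
Import numFieldNormedType.Exports.

Local Open Scope classical_set_scope.
Local Open Scope ring_scope.

Record sgraph := SGraph {
  vertex :> countType;
  adj : rel vertex;
  adj_sym : symmetric adj;
  adj_irrefl : irreflexive adj }.

Section Graph.
Variable G : sgraph.

Definition graph_ball (x : G) (r : nat) : set G :=
  [set y | exists2 p : seq G, path (@adj G) x p & last x p = y /\ (size p <= r)%N].

Definition at_distance (x y : G) (n : nat) : Prop :=
  graph_ball x n y /\ forall m, graph_ball x m y -> (n <= m)%N.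

(* The balls of the graphs considered here are finite, so that [fset_set]
   does not take its default value. *)
Definition growth_rate (R : realType) (x : G) : R :=
  limn_inf (fun r : nat => (#|` fset_set (graph_ball x r)|%:R : R) `^ (r%:R)^-1).

(* An edge is the unordered pair of its two end points. *)
Definition edge : Type :=
  {E : {fset G} | `[< exists x y : G, adj x y /\ E = [fset x; y]%fset >]}.

HB.instance Definition _ := Countable.on edge.

Definition config : Type :=
  g_sigma_algebraType
    [set A : set (edge -> bool) | exists e : edge, A = [set w | w e]].

HB.instance Definition _ := Measurable.on config.

Definition open_adj (w : config) (x y : G) : bool :=
  `[< exists2 e : edge, val e = [fset x; y]%fset & w e >].

Definition joined (w : config) (x y : G) : Prop :=
  exists2 p : seq G, path (open_adj w) x p & last x p = y.

Definition cluster (w : config) (x : G) : set G := [set y | joined w x y].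

Definition has_infinite_cluster (w : config) : Prop :=
  exists x : G, infinite_set (cluster w x).

Section Percolation.
Variable R : realType.

(* The coordinates of a configuration are independent Bernoulli(p) variables;
   by the pi-lambda theorem this characterizes the product measure. *)
Definition bernoulli_percolation (p : R) (P : probability config R) : Prop :=
  forall (s : {fset edge}) (b : edge -> bool),
    P [set w | forall e, e \in s -> w e = b e] =
    (\prod_(e <- s) (if b e then p else 1 - p))%:E.

Definition critical_probability (P : R -> probability config R) : R :=
  inf [set p : R | 0 <= p <= 1 /\ {ae P p, forall w, has_infinite_cluster w}].

End Percolation.
End Graph.

Section BoxProduct.
Variables G H : sgraph.

Definition box_adj (u v : G * H) : bool :=
  (adj u.1 v.1 && (u.2 == v.2)) || ((u.1 == v.1) && adj u.2 v.2).

Lemma box_adj_sym : symmetric box_adj.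
Proof.
by move=> u v; rewrite /box_adj (adj_sym u.1) (adj_sym u.2) (eq_sym u.1) (eq_sym u.2).
Qed.

Lemma box_adj_irrefl : irreflexive box_adj.
Proof. by move=> u; rewrite /box_adj !adj_irrefl andbF. Qed.

Definition box : sgraph := SGraph box_adj_sym box_adj_irrefl.
End BoxProduct.

Definition line_adj (k l : int) : bool := `|k - l| == 1.

Lemma line_adj_sym : symmetric line_adj.
Proof. by move=> k l; rewrite /line_adj distrC. Qed.

Lemma line_adj_irrefl : irreflexive line_adj.
Proof. by move=> k; rewrite /line_adj subrr normr0. Qed.

Definition line : sgraph := SGraph line_adj_sym line_adj_irrefl.

Section RegularTree.
Variable d : nat.

(* The vertices of the d-regular tree are the words over a d-letter alphabet
   without two equal consecutive letters (the Cayley graph of the free product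
   of d copies of Z/2); the root is the empty word, and the neighbours of a word
   are the reduced words obtained by adding or removing its first letter. *)
Definition word : Type := {s : seq 'I_d | sorted [rel a b | a != b] s}.

HB.instance Definition _ := Countable.on word.

Definition child (u v : word) : bool :=
  (val v != [::]) && (behead (val v) == val u).

Definition tree_adj (u v : word) : bool := child u v || child v u.

Lemma child_size u v : child u v -> size (val v) = (size (val u)).+1.
Proof. by rewrite /child; case: (val v) => [|a s] //= /eqP ->. Qed.

Lemma tree_adj_sym : symmetric tree_adj.
Proof. by move=> u v; rewrite /tree_adj orbC. Qed.

Lemma tree_adj_irrefl : irreflexive tree_adj.
Proof.
by move=> u; apply/negP => /orP[] /child_size /eqP; rewrite -addn1 -{1}[size _]addn0 eqn_add2l.
Qed.

Definition regular_tree : sgraph := SGraph tree_adj_sym tree_adj_irrefl.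

Definition tree_root : regular_tree := exist _ [::] isT.

(* Sanity check: [regular_tree] is d-regular, connected and acyclic. *)

Definition flip_letter (a : 'I_d) (s : seq 'I_d) : seq 'I_d :=
  if s is b :: t then if a == b then t else a :: s else [:: a].

Lemma flip_letter_reduced a s :
  sorted [rel a b | a != b] s -> sorted [rel a b | a != b] (flip_letter a s).
Proof.
case: s => [|b s] //= hs; case: eqVneq => [_|ab] /=; last by rewrite ab.
exact: path_sorted hs.
Qed.

Definition flip (u : word) (a : 'I_d) : word :=
  exist _ (flip_letter a (val u)) (flip_letter_reduced a (valP u)).

Lemma regular_tree_regular (u : regular_tree) :
  exists2 s : seq regular_tree, uniq s & size s = d /\ s =i adj u.
Proof.
exists [seq flip u a | a <- enum 'I_d].
  rewrite map_inj_uniq ?enum_uniq// => a b /(congr1 val) /=.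
  case: (val u) => [|c s] /=; first by case.
  case: (eqVneq a c) => [->|ac]; case: (eqVneq b c) => [->|bc] //=.
  - by move=> /(congr1 size) /= /eqP; rewrite -addn2 -{1}[size s]addn0 eqn_add2l.
  - by move=> /(congr1 size) /= /eqP; rewrite -addn2 -{2}[size s]addn0 eqn_add2l.
  - by case.
split; first by rewrite size_map size_enum_ord.
move=> v; rewrite -[v \in adj u]/(tree_adj u v); apply/mapP/idP => [[a _ ->]|].
  rewrite /tree_adj /child /=; case: (val u) => [|c s] //=.
  by case: (eqVneq a c) => [_|ac] /=; rewrite ?eqxx ?orbT.
rewrite /tree_adj /child => /orP[]/andP[].
  case hv: (val v) (valP v) => [|a s] // + _ /= /eqP sE; rewrite {s}sE in hv * => red.
  exists a; first exact: mem_enum.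
  apply: val_inj; rewrite hv /=; case: (val u) red => [|c s] //= /andP[ac _].
  by rewrite (negbTE ac).
case hu: (val u) => [|c s] // _ /= /eqP sE; exists c; first exact: mem_enum.
by apply: val_inj; rewrite /= hu /= eqxx sE.
Qed.

Lemma regular_tree_connected (u v : regular_tree) : exists r, graph_ball u r v.
Proof.
have to_root n : forall w : regular_tree, size (val w) = n ->
    exists2 p, path (@adj regular_tree) w p & last w p = tree_root.
  elim: n => [|n IH] w sw; first by exists [::] => //=; apply/val_inj/nilP/eqP.
  case hw: (val w) (valP w) => [|a s] red; first by rewrite hw in sw.
  pose w' : regular_tree := exist _ s (path_sorted red).
  have [|p pp lp] := IH w'; first by move: sw; rewrite hw /= => -[].
  by exists (w' :: p) => //=; rewrite pp andbT /tree_adj /child hw /= eqxx orbT.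
have [p pp lp] := to_root _ u erefl; have [q pq lq] := to_root _ v erefl.
pose q' := rev (belast v q).
have pq' : path (@adj regular_tree) tree_root q'.
  rewrite -lq /q' rev_path.
  by rewrite (eq_path (e' := @adj regular_tree)) // => x y; rewrite adj_sym.
exists (size (p ++ q')), (p ++ q'); first by rewrite cat_path pp lp.
split => //; rewrite last_cat lp /q'.
by case: q {pq q' pq'} lq => [|y q] //= _; rewrite rev_cons last_rcons.
Qed.

Lemma regular_tree_acyclic (c : seq regular_tree) :
  (2 < size c)%N -> uniq c -> ~~ cycle (@adj regular_tree) c.
Proof.
move=> c2 uc; apply/negP => cc.
have [u uc_ umax] : exists2 u, u \in c &
    forall v, v \in c -> (size (val v) <= size (val u))%N.
  case: c c2 {uc cc} => // x c _; elim: c x => [|y c IH] x.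
    by exists x; rewrite ?mem_head// => v; rewrite inE => /eqP ->.
  have [u uc umax] := IH y.
  have [xu|/ltnW ux] := leqP (size (val x)) (size (val u)).
    by exists u => [|v]; rewrite inE ?uc ?orbT// => /orP[/eqP->|/umax].
  exists x => [|v]; first exact: mem_head.
  by rewrite inE => /orP[/eqP->|/umax vu] //; apply: leq_trans ux.
have [i c' cE] := rot_to uc_.
have top v : v \in c -> tree_adj u v -> val v = behead (val u).
  move=> vc /orP[/child_size vS|/andP[_ /eqP->]] //.
  by have := umax v vc; rewrite vS ltnn.
have mem v : v \in u :: c' -> v \in c by rewrite -cE mem_rot.
move: cc uc c2; rewrite -(rot_cycle i) -(rot_uniq i) -(size_rot i) cE.
case: c' mem {cE} => // x c' mem; case/lastP: c' mem => // c' y mem /=.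
rewrite -rcons_cons !rcons_path last_rcons => /and3P[ux _ yu].
have xtop : val x = behead (val u).
  by apply: top ux; apply: mem; rewrite !inE eqxx orbT.
have ytop : val y = behead (val u).
  apply: top; last by rewrite tree_adj_sym.
  by apply: mem; rewrite !inE mem_rcons inE eqxx !orbT.
have xy : x = y by apply: val_inj; rewrite xtop ytop.
by rewrite xy => /andP[_ /andP[]]; rewrite mem_rcons inE eqxx.
Qed.

End RegularTree.

Definition tree_line (d : nat) : sgraph := box (regular_tree d) line.

(* [v n] stands for a vertex of the tree at distance n from the root. The limit
   exists by supermultiplicativity, so [limn] does not take its default value. *)
Definition alpha (R : realType) (d : nat) (Pp : probability (config (tree_line d)) R)
    (v : nat -> regular_tree d) : R :=
  let o : tree_line d := (tree_root d, 0) in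
  limn (fun n : nat =>
    fine (Pp [set w | joined w o ((v n, 0) : tree_line d)]) `^ (n%:R)^-1).

(* Main.v *)
Require Import Defs.
From mathcomp Require Import all_boot all_order all_algebra finmap perm.
From mathcomp Require Import all_classical all_reals all_analysis.
From mathcomp Require Import ring lra zify.

Set Implicit Arguments.
Unset Strict Implicit.
Unset Printing Implicit Defensive.

Import Order.TTheory GRing.Theory Num.Theory.
Import numFieldNormedType.Exports.

Local Open Scope classical_set_scope.
Local Open Scope ring_scope.

(** Let tau(q, n) be the probability at parameter q that the root is connected to a
    vertex of the tree at distance n, and suppose that tau(p_c, n) > (d - 1) ^ (- n)
    for some n > 0. This lower bound is witnessed by a finite set of edges, and
    the probability that those edges connect the two vertices is a polynomial in
    the parameter, so that it persists at some 0 < q < p_c ([joined_approx],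
    [avg_continuous]). It remains to find an infinite cluster almost surely at q,
    which contradicts the definition of p_c. The exponential growth of the tree
    makes this possible through a branching process.

    By symmetry of the tree ([tree_symmetry]) and Harris' inequality ([avg_harris]),
    copies of the finite connection can be concatenated along a geodesic ray, and
    the first and last few copies can be replaced by straight open segments. The
    resulting connection from a vertex u to a descendant y stays in the cone of u
    and has no edge inside the cone of a vertex at the level of y ([conn_slab]).
    For a long chain, its probability times the number of descendants exceeds 2,
    since each copy gains the factor tau(q, n) (d - 1) ^ n > 1, while the straight
    segments cost a constant.

    Connections that start from vertices of successive generations now use disjoint
    slabs, so that the connected descendants contain a supercritical Galton-Watson
    process, and the cone of u reaches every height with probability at least some
    c > 0 independent of u and of the height ([reach_with_prob]). Disjoint cones
    are independent, and there are infinitely many of them: almost surely one of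
    them contains an infinite cluster ([infinite_cluster_ae]).

    Hence tau(p_c, n) <= (d - 1) ^ (- n) for all n > 0, and alpha(p_c) <= 1 / (d - 1).
    Finally the ball of radius r has between (d - 1) ^ r and a quadratic multiple
    of (d - 1) ^ r vertices, which gives the growth rate. *)

(** * Averaging over finitely many coordinates *)

Section Averaging.
Variables (R : realFieldType) (E : eqType).
Implicit Types (p : R) (e : E) (w : E -> bool) (s : seq E) (D : set E).
Implicit Types (f g h : (E -> bool) -> R).

Definition upd w e (b : bool) : E -> bool :=
  fun e' => if e' == e then b else w e'.

Definition depends_on (T : Type) D (f : (E -> bool) -> T) :=
  forall w w', (forall e, D e -> w e = w' e) -> f w = f w'.

Definition avg1 p e f : (E -> bool) -> R :=
  fun w => p * f (upd w e true) + (1 - p) * f (upd w e false).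

(** The conditional expectation of [f] given the coordinates outside [s], for
    independent Bernoulli(p) coordinates. It is again a function of the
    configuration, so that averages over different sets can be nested, and
    locality, independence and Harris' inequality become statements about
    iterating [avg1]. *)
Definition avg p s f : (E -> bool) -> R := foldr (avg1 p) f s.

Lemma depends_onS T D D' (f : (E -> bool) -> T) :
  D `<=` D' -> depends_on D f -> depends_on D' f.
Proof. by move=> DD hf w w' ww; apply: hf => e /DD /ww. Qed.

Lemma avg_cat p s s' f : avg p (s ++ s') f = avg p s (avg p s' f).
Proof. by rewrite /avg foldr_cat. Qed.

Lemma avg1_depends p e D f : depends_on D f -> depends_on (D `\ e) (avg1 p e f).
Proof.
move=> hf w w' ww; rewrite /avg1; congr (_ * _ + _ * _);
  apply: hf => e' De'; rewrite /upd; case: eqVneq => // /eqP ne; apply: ww; split=> //.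
Qed.

Lemma avg_depends p s D f :
  depends_on D f -> depends_on (D `\` [set e | e \in s]) (avg p s f).
Proof.
elim: s => [|e s IH] hf /=; first by apply: depends_onS hf => e De; split.
move/IH: (hf) => /(avg1_depends p (e := e)); apply: depends_onS => e' /= [[De' es] ee].
by split=> //=; rewrite inE => /orP[/eqP|].
Qed.

Lemma avg_const p s f w w' :
  depends_on [set e | e \in s] f -> avg p s f w = avg p s f w'.
Proof. by move=> hf; apply: (avg_depends p (s := s) hf) => e [] /=. Qed.

Lemma avg1_free p e D f : depends_on D f -> ~ D e -> avg1 p e f = f.
Proof.
move=> hf nD; apply/funext => w; rewrite /avg1.
have fE b : f (upd w e b) = f w.
  by apply: hf => e' De'; rewrite /upd; case: eqVneq De' => // ->.
by rewrite !fE; ring.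
Qed.

Lemma avg_free p s D f :
  depends_on D f -> (forall e, e \in s -> ~ D e) -> avg p s f = f.
Proof.
move=> hf; elim: s => [|e s IH] //= sD.
rewrite IH ?(avg1_free p hf) //; first by apply: sD; rewrite mem_head.
by move=> e' es; apply: sD; rewrite inE es orbT.
Qed.

(** Independence: a factor that ignores the averaged coordinates is a constant
    for the average. *)
Lemma avg_free_mul p s D f g : depends_on D f -> (forall e, e \in s -> ~ D e) ->
  avg p s (fun w => f w * g w) = fun w => f w * avg p s g w.
Proof.
move=> hf; elim: s => [|e s IH] //= sD.
rewrite IH; last by move=> e' es; apply: sD; rewrite inE es orbT.
apply/funext => w; rewrite /avg1.
have fE b : f (upd w e b) = f w.
  apply: hf => e' De'; rewrite /upd; case: eqVneq De' => // -> /sD.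
  by rewrite mem_head => /(_ isT).
by rewrite !fE; ring.
Qed.

Lemma avg1C p e e' f : avg1 p e (avg1 p e' f) = avg1 p e' (avg1 p e f).
Proof.
have [->//|ne] := eqVneq e e'.
have updE w b b' : upd (upd w e b) e' b' = upd (upd w e' b') e b.
  apply/funext => x; rewrite /upd; case: (eqVneq x e') => // ->.
  by rewrite eq_sym (negbTE ne).
by apply/funext => w; rewrite /avg1 !updE; ring.
Qed.

Lemma avg_catC p s s' f : avg p (s ++ s') f = avg p (s' ++ s) f.
Proof.
rewrite !avg_cat; elim: s => [|e s IH] //=; rewrite IH.
by elim: s' {IH} => [|e' s' IH] //=; rewrite avg1C IH.
Qed.

Lemma avg_undup p s f : avg p (undup s) f = avg p s f.
Proof.
elim: s => [|e s IH] //=; case: ifP => es; rewrite /= IH //.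
rewrite (avg1_free p (D := setT `\` [set e | e \in s])) //.
  by apply: avg_depends => w w' ww; congr f; apply/funext => x; exact: ww.
by case=> _ /(_ es).
Qed.

(** The average over [s'] is already constant, hence unchanged by averaging over
    [s] afterwards. *)
Lemma avg_widen p s s' f w w' : depends_on [set e | e \in s'] f ->
  avg p (s ++ s') f w = avg p s' f w'.
Proof.
move=> hf; rewrite avg_cat (avg_free (D := set0) p (s := s)) //; first exact: avg_const.
- by move=> v v' _; exact: avg_const.
- by move=> e _ [].
Qed.

(** This makes the expectation of a local observable independent of the finite
    set used to compute it: both averages equal the one over [s' ++ s]. *)
Lemma avg_subset p s s' f w w' : depends_on [set e | e \in s'] f ->
  {subset s' <= s} -> avg p s f w = avg p s' f w'.
Proof.
move=> hf ss; rewrite -(avg_widen p s w w' hf) avg_catC.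
by rewrite (avg_widen p s' w w) //; exact: depends_onS hf.
Qed.

Lemma avg_le p s f g w : 0 <= p <= 1 ->
  (forall w, f w <= g w) -> avg p s f w <= avg p s g w.
Proof.
move=> /andP[p0 p1] fg; elim: s w => [|e s IH] w //=.
by rewrite lerD // ler_wpM2l // subr_ge0.
Qed.

Lemma avg_cst p s (c : R) w : avg p s (fun _ => c) w = c.
Proof. by elim: s w => [|e s IH] w //=; rewrite /avg1 !IH; ring. Qed.

Lemma avgD p s f g w : avg p s (fun w => f w + g w) w = avg p s f w + avg p s g w.
Proof. by elim: s w => [|e s IH] w //=; rewrite /avg1 !IH; ring. Qed.

Lemma avgZ p s (c : R) f w : avg p s (fun w => c * f w) w = c * avg p s f w.
Proof. by elim: s w => [|e s IH] w //=; rewrite /avg1 !IH; ring. Qed.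

Lemma avg_sum p s (I : Type) (r : seq I) (F : I -> (E -> bool) -> R) w :
  avg p s (fun w => \sum_(i <- r) F i w) w = \sum_(i <- r) avg p s (F i) w.
Proof.
elim: r => [|i r IH].
  by rewrite big_nil -[RHS](avg_cst p s 0 w); congr avg; apply/funext => v; rewrite big_nil.
rewrite big_cons -IH -avgD; congr avg; apply/funext => v; exact: big_cons.
Qed.

Definition increasing f := forall w w', (forall e, w e ==> w' e) -> f w <= f w'.

Lemma avg1_increasing p e f : 0 <= p <= 1 -> increasing f -> increasing (avg1 p e f).
Proof.
move=> /andP[p0 p1] hf w w' ww.
have fE b : f (upd w e b) <= f (upd w' e b).
  by apply: hf => x; rewrite /upd; case: ifP => // _; case: b.
by rewrite lerD // ler_wpM2l // ?subr_ge0.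
Qed.

Lemma avg_increasing p s f : 0 <= p <= 1 -> increasing f -> increasing (avg p s f).
Proof. by move=> hp hf; elim: s => [|e s IH] //=; apply: avg1_increasing. Qed.

(** Harris' inequality. For one coordinate it is Chebyshev's sum inequality, whose
    defect is [p (1 - p) (F1 - F0) (G1 - G0)]; averaging preserves monotonicity,
    so that the coordinates can be integrated out one after the other. *)
Lemma avg_harris p s f g w : 0 <= p <= 1 -> increasing f -> increasing g ->
  avg p s f w * avg p s g w <= avg p s (fun w => f w * g w) w.
Proof.
move=> hp hf hg; elim: s w => [|e s IH] w //=.
set F := avg p s f; set G := avg p s g.
have hF : increasing F by exact: avg_increasing.
have hG : increasing G by exact: avg_increasing.
have up : forall x, upd w e false x ==> upd w e true x.
  by move=> x; rewrite /upd; case: ifP => // _; apply: implybb.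
have F01 := hF _ _ up; have G01 := hG _ _ up.
have := IH (upd w e true); have := IH (upd w e false).
rewrite -/F -/G /avg1; case/andP: hp => p0 p1.
move: (F (upd _ _ true)) (F (upd _ _ false)) F01 => F1 F0 F01.
move: (G (upd _ _ true)) (G (upd _ _ false)) G01 => G1 G0 G01.
move: (avg _ _ _ (upd _ _ true)) (avg _ _ _ (upd _ _ false)) => H1 H0 h0 h1.
have hk : 0 <= p * (1 - p) * ((F1 - F0) * (G1 - G0)).
  by apply: mulr_ge0; apply: mulr_ge0; rewrite ?subr_ge0.
have k1 : 0 <= p * (H1 - F1 * G1) by rewrite mulr_ge0 // subr_ge0.
have k0 : 0 <= (1 - p) * (H0 - F0 * G0) by rewrite mulr_ge0 // subr_ge0.
rewrite -subr_ge0; apply: le_trans (addr_ge0 (addr_ge0 k1 k0) hk) _.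
by rewrite le_eqVlt; apply/orP; left; apply/eqP; ring.
Qed.

(** The independence underlying a branching process: [C i] tells whether the
    child [i] is present and [a i] whether its line survives. The lines use
    disjoint sets of coordinates, none of them used by the [C i], so that the
    probability of survival of each line can be substituted in the product. *)
Lemma avg_branching p (I : eqType) (r : seq I) (S : I -> seq E)
    (C : I -> (E -> bool) -> R) (a : I -> (E -> bool) -> R) D w0 :
  uniq r ->
  (forall i, i \in r -> depends_on D (C i)) ->
  (forall i e, i \in r -> e \in S i -> ~ D e) ->
  (forall i, i \in r -> depends_on [set e | e \in S i] (a i)) ->
  (forall i j e, i \in r -> j \in r -> i != j -> e \in S i -> e \notin S j) ->
  avg p (flatten [seq S i | i <- r]) (fun w => \prod_(i <- r) (1 - C i w * a i w)) =
  fun w => \prod_(i <- r) (1 - C i w * avg p (S i) (a i) w0).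
Proof.
elim: r => [|i r IH] /=.
  by move=> *; apply/funext => w; rewrite !big_nil.
move=> /andP[ir ur] hC CS ha SS; rewrite avg_cat.
have -> : (fun w => \prod_(j <- i :: r) (1 - C j w * a j w)) =
    (fun w => (1 - C i w * a i w) * \prod_(j <- r) (1 - C j w * a j w)).
  by apply/funext => w; rewrite big_cons.
have mem j : j \in r -> j \in i :: r by rewrite inE => ->; rewrite orbT.
rewrite (avg_free_mul p (D := D `|` [set e | e \in S i])); first last.
- move=> e /flattenP[_ /mapP[j jr ->]] ej [De|/= ei]; first exact: (CS j e (mem _ jr)).
  have ij : i != j by apply: contraNneq ir => ->.
  by have := SS i j e (mem_head _ _) (mem _ jr) ij ei; rewrite ej.
- move=> w w' ww; rewrite (hC i _ w w') ?(ha i _ w w') ?mem_head // => e De; apply: ww; by [left|right].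
rewrite IH //; first last.
- by move=> j k e jr kr; apply: SS; apply: mem.
- by move=> j jr; apply: ha; apply: mem.
- by move=> j e jr; apply: CS; apply: mem.
- by move=> j jr; apply: hC; apply: mem.
under [X in avg p (S i) X]eq_fun do rewrite mulrC.
rewrite (avg_free_mul p (D := D)); first last.
- by move=> e; apply: CS; rewrite mem_head.
- move=> w w' ww; rewrite !big_seq; apply: eq_bigr => j jr; by rewrite (hC j (mem _ jr) w w' ww).
apply/funext => w; rewrite big_cons mulrC; congr (_ * _).
rewrite avgD avg_cst; under [X in avg p (S i) X]eq_fun do rewrite -mulN1r mulrCA mulN1r.
rewrite (avg_free_mul p (D := D)); first last.
- by move=> e; apply: CS; rewrite mem_head.
- by apply: hC; rewrite mem_head.
rewrite mulrC; under [X in avg p (S i) X]eq_fun do rewrite -mulN1r.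
by rewrite avgZ mulN1r mulNr mulrC (@avg_const p (S i) (a i) w w0) //; apply: ha; rewrite mem_head.
Qed.

End Averaging.

(** Averages are invariant under relabeling of the coordinates; this is the form
    taken by invariance of the measure under graph automorphisms. *)
Lemma avg_map (R : realFieldType) (E E' : eqType) (phi : E -> E') (p : R) s f w :
  injective phi ->
  avg p [seq phi e | e <- s] (fun w => f (w \o phi)) w = avg p s f (w \o phi).
Proof.
move=> inj; elim: s w => [|e s IH] w //=; rewrite /avg1 !IH.
have updE b : upd w (phi e) b \o phi = upd (w \o phi) e b.
  by apply/funext => x; rewrite /upd /= inj_eq.
by rewrite !updE.
Qed.

(** The average is a polynomial in [p]. *)
Lemma avg_continuous (R : realType) (E : eqType) s (f : (E -> bool) -> R) w :
  continuous (fun p : R => avg p s f w).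
Proof.
elim: s w => [|e s IH] w /= p; first exact: cst_continuous.
apply: cvgD; apply: cvgM; try exact: IH.
  exact: cvg_id.
by apply: cvgB; [exact: cvg_cst|exact: cvg_id].
Qed.

(** * Local events *)

Section LocalEvents.
Variables (R : realType) (G : sgraph) (p : R) (P : probability (config G) R).
Hypothesis hP : bernoulli_percolation p P.

Definition prob_of (s : seq (edge G)) (A : config G -> Prop) (w : config G) : R :=
  avg p s (fun w => `[<A w>]%:R) w.

Lemma measurable_coordinate (e : edge G) b : measurable [set w : config G | w e = b].
Proof.
have h : measurable [set w : config G | w e].
  by apply: sub_gen_smallest; exists e.
case: b => //; suff -> : [set w : config G | w e = false] = ~` [set w | w e].
  exact: measurableC.
by apply/seteqP; split=> w /=; case: (w e).
Qed.

(** Probabilities of local events are averages. The induction needs a stronger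
    claim, in which some coordinates [s0] are already fixed to the values [b]. *)
Lemma local_event s (A : config G -> Prop) w : depends_on [set e | e \in s] A ->
  measurable (A : set (config G)) /\ P A = (prob_of s A w)%:E.
Proof.
pose cyl (s0 : {fset edge G}) b := [set w : config G | forall e, e \in s0 -> w e = b e].
have gen s' : forall (s0 : {fset edge G}) b, uniq s' -> (forall e, e \in s' -> e \notin s0) ->
    depends_on [set e | (e \in s') || (e \in s0)] A ->
    measurable (cyl s0 b `&` A) /\
    P (cyl s0 b `&` A) =
      ((\prod_(e <- s0) (if b e then p else 1 - p)) * prob_of s' A b)%:E.
  elim: s' => [|e s' IH] s0 b /=.
    move=> _ _ dA; have mcyl : measurable (cyl s0 b).
      have -> : cyl s0 b = \bigcap_(e in [set` s0]) [set w | w e = b e] by [].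
      by apply: fin_bigcap_measurable => // e _; exact: measurable_coordinate.
    rewrite /prob_of /=; case: (asboolP (A b)) => Ab; last first.
      rewrite (_ : cyl _ _ `&` _ = set0) ?measure0 ?mulr0//.
      by apply/seteqP; split=> // v /= [cv]; rewrite (dA v b).
    rewrite (_ : cyl _ _ `&` _ = cyl s0 b); last first.
      by apply/seteqP; split=> [v []//|v cv]; split=> //; rewrite (dA v b).
    by split=> //; rewrite mulr1 -hP.
  move=> /andP[es us] dis dA.
  have es0 : e \notin s0 by apply: dis; rewrite mem_head.
  pose s1 := (e |` s0)%fset.
  have IHc c : measurable (cyl s1 (upd b e c) `&` A) /\
     P (cyl s1 (upd b e c) `&` A) =
      ((\prod_(e0 <- s1) (if upd b e c e0 then p else 1 - p)) * prob_of s' A (upd b e c))%:E.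
    apply: (IH s1 (upd b e c)) => //.
      move=> e' es'; rewrite !inE negb_or dis ?inE ?es' ?orbT// andbT.
      by apply: contraNneq es => <-.
    by apply: depends_onS dA => e1 /=; rewrite !inE; case: (e1 \in s') => /=; rewrite ?orbT ?orbF.
  have {}IHc c : measurable (cyl s1 (upd b e c) `&` A) /\
     P (cyl s1 (upd b e c) `&` A) = ((if c then p else 1 - p) *
        (\prod_(e <- s0) (if b e then p else 1 - p)) * prob_of s' A (upd b e c))%:E.
    have [m ->] := IHc c; split=> //; congr (_ * _)%:E.
    rewrite big_fsetU1 //= /upd eqxx; congr (_ * _).
    by apply: eq_big_seq => e' e's0; case: eqVneq => // ee; rewrite -ee e's0 in es0.
  have [m1 P1] := IHc true; have [m0 P0] := IHc false.
  have -> : cyl s0 b `&` A = (cyl s1 (upd b e true) `&` A) `|` (cyl s1 (upd b e false) `&` A).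
    apply/seteqP; split => [v [cv Av]|v [] [cv Av]].
    - case ve: (v e); [left|right]; split=> // e'; rewrite !inE /upd; case: eqVneq => [->|_] //=; exact: cv.
    - split=> // e' e's0; have := cv e'; rewrite !inE e's0 orbT /upd => ->//.
      by case: eqVneq => // ee; rewrite -ee e's0 in es0.
    - split=> // e' e's0; have := cv e'; rewrite !inE e's0 orbT /upd => ->//.
      by case: eqVneq => // ee; rewrite -ee e's0 in es0.
  split; first exact: measurableU.
  have dis01 : (cyl s1 (upd b e true) `&` A) `&` (cyl s1 (upd b e false) `&` A) = set0.
    apply/seteqP; split=> // v [[c1 _] [c0 _]].
    by have := c1 e; rewrite c0 ?inE ?eqxx // /upd eqxx => /(_ isT).
  transitivity (P (cyl s1 (upd b e true) `&` A) + P (cyl s1 (upd b e false) `&` A))%E.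
    exact: measureU.
  by rewrite P1 P0 /prob_of /= -EFinD /avg1; congr (_%:E); ring.
move=> dA; have [||m E] := gen (undup s) fset0 w (undup_uniq s).
- by move=> e _; rewrite inE.
- by apply: depends_onS dA => e /=; rewrite mem_undup => ->.
have cylE : cyl fset0 w = setT by apply/seteqP; split=> // v _ e; rewrite inE.
move: m E; rewrite cylE setTI => m ->; split=> //.
by rewrite big_seq_fset0 mul1r /prob_of avg_undup.
Qed.

End LocalEvents.

(** * Open paths in a set of edges *)

Section OpenPaths.
Variable G : sgraph.
Implicit Types (w : config G) (x y z : G) (D : set (edge G)).

(** Closing the edges outside [D] makes [joined (restr w D)] the connection by
    open paths that stay inside [D]. *)
Definition restr w D : config G := fun e => w e && `[< D e >].

Lemma open_adj_mono w w' x y :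
  (forall e, w e ==> w' e) -> open_adj w x y -> open_adj w' x y.
Proof.
move=> ww /asboolP[e exy we]; apply/asboolP; exists e => //.
by have := ww e; rewrite we.
Qed.

Lemma joined_mono w w' x y :
  (forall e, w e ==> w' e) -> joined w x y -> joined w' x y.
Proof.
move=> ww [q pq lq]; exists q => //; apply: sub_path pq => a b; exact: open_adj_mono.
Qed.

Lemma restr_mono w w' D D' : (forall e, w e ==> w' e) -> D `<=` D' ->
  forall e, restr w D e ==> restr w' D' e.
Proof.
move=> ww DD e; rewrite /restr; apply/implyP => /andP[we /asboolP De].
by have := ww e; rewrite we /= => ->; apply/asboolP/DD.
Qed.

Lemma joinedS w D D' x y : D `<=` D' ->
  joined (restr w D) x y -> joined (restr w D') x y.
Proof. by move=> DD; apply: joined_mono; apply: restr_mono => // e; apply: implybb. Qed.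

Lemma joined_restr w D x y : joined (restr w D) x y -> joined w x y.
Proof. by apply: joined_mono => e; rewrite /restr; apply/implyP => /andP[]. Qed.

Lemma joined_trans w x y z : joined w x y -> joined w y z -> joined w x z.
Proof.
move=> [q pq lq] [r pr lr]; exists (q ++ r); last by rewrite last_cat lq.
by rewrite cat_path pq lq.
Qed.

Lemma joined_refl w x : joined w x x.
Proof. by exists [::]. Qed.

Lemma joined_depends D x y : depends_on D (fun w => joined (restr w D) x y).
Proof.
move=> w w' ww; suff -> : restr w D = restr w' D by [].
by apply/funext => e; rewrite /restr; case: asboolP => [/ww->|]; rewrite ?andbT ?andbF.
Qed.

Lemma edge_exists x y : adj x y -> exists e : edge G, val e = [fset x; y]%fset.
Proof.
move=> xy; have h : `[< exists x' y' : G, adj x' y' /\ [fset x; y]%fset = [fset x'; y']%fset >].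
  by apply/asboolP; exists x, y.
by exists (exist (fun E : {fset G} => `[< exists x y : G, adj x y /\ E = [fset x; y]%fset >]) _ h).
Qed.

Lemma edge_ends (e : edge G) : exists x y : G, adj x y /\ val e = [fset x; y]%fset.
Proof. by case: e => E /= /asboolP. Qed.

Definition edge_prefix m : seq (edge G) := pmap choice.unpickle (iota 0 m).

Lemma edge_prefixS m n : (m <= n)%N -> {subset edge_prefix m <= edge_prefix n}.
Proof.
move=> mn e; rewrite /edge_prefix !mem_pmap => /mapP[k km ->]; apply: map_f.
by move: km; rewrite !mem_iota /= !add0n => /leq_trans; apply.
Qed.

Lemma edge_prefix_pickle (e : edge G) : e \in edge_prefix (choice.pickle e).+1.
Proof.
by rewrite mem_pmap; apply/mapP; exists (choice.pickle e); rewrite ?choice.pickleK// mem_iota /= add0n.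
Qed.

(** The sets [edge_prefix m] exhaust the edges, and a path has finitely many edges. *)
Lemma joined_finite w x y : joined w x y ->
  exists m, joined (restr w [set e | e \in edge_prefix m]) x y.
Proof.
move=> [q pq <-]; elim: q x pq => [|z q IH] x /=; first by exists 0%N; exact: joined_refl.
move=> /andP[/asboolP[e exz we] /IH[m jm]].
exists (maxn (choice.pickle e).+1 m); apply: (joined_trans (y := z)).
  exists [:: z] => //=; rewrite andbT; apply/asboolP; exists e => //.
  rewrite /restr we; apply/asboolP; apply: edge_prefixS (edge_prefix_pickle e).
  exact: leq_maxl.
by apply: joinedS jm; apply: edge_prefixS; exact: leq_maxr.
Qed.

Section Transport.
Variable f : G -> G.
Hypothesis finj : injective f.
Hypothesis fadj : forall x y, adj x y -> adj (f x) (f y).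

Lemma edge_map_proof (e : edge G) :
  `[< exists x y : G, adj x y /\ (f @` val e)%fset = [fset x; y]%fset >].
Proof.
have [x [y [xy exy]]] := edge_ends e; apply/asboolP; exists (f x), (f y).
by split; [exact: fadj|rewrite exy imfsetU !imfset_fset1].
Qed.

Definition edge_map (e : edge G) : edge G :=
  exist (fun E : {fset G} => `[< exists x y : G, adj x y /\ E = [fset x; y]%fset >]) _ (edge_map_proof e).

Lemma edge_map_inj : injective edge_map.
Proof.
move=> e e' /(congr1 val) /= ee; apply: val_inj; apply/fsetP => x.
by have /fsetP/(_ (f x)) := ee; rewrite !mem_imfset.
Qed.

Lemma joined_map w (s : seq (edge G)) x y :
  joined (restr (w \o edge_map) [set e | e \in s]) x y ->
  joined (restr w [set e | e \in map edge_map s]) (f x) (f y).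
Proof.
move=> [q pq <-]; exists (map f q); last by rewrite last_map.
rewrite path_map; apply: sub_path pq => a b /asboolP[e eab] /andP[/= we /asboolP es].
apply/asboolP; exists (edge_map e); first by rewrite /= eab imfsetU !imfset_fset1.
by rewrite /restr we; apply/asboolP => /=; apply: map_f.
Qed.

End Transport.
End OpenPaths.

(** * Quantitative connections *)

Section Connection.
Variables (R : realType) (G : sgraph).
Implicit Types (D : set (edge G)) (x y z : G) (p k : R).

Lemma indicator_le (A B : Prop) : (A -> B) -> (`[<A>]%:R : R) <= `[<B>]%:R.
Proof. by move=> AB; rewrite ler_nat; case: asboolP => // /AB /asboolP ->. Qed.

Lemma indicator_mul (A B : Prop) : (`[<A>]%:R : R) * `[<B>]%:R = `[<A /\ B>]%:R.
Proof. by rewrite asbool_and -natrM mulnb. Qed.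

Lemma indicator_depends D (A : config G -> Prop) :
  depends_on D A -> depends_on D (fun w => `[<A w>]%:R : R).
Proof. by move=> dA w w' /dA ->. Qed.

Definition joined_in (s : seq (edge G)) x y (w : config G) : Prop :=
  joined (restr w [set e | e \in s]) x y.

(** Finitely many edges of [D] already connect [x] to [y] with probability at
    least [k]. Finiteness of the set keeps the event local, and then the average
    does not depend on [w]. *)
Definition connected_with_prob p D x y k : Prop :=
  exists2 s : seq (edge G), (forall e, e \in s -> D e) &
    forall w, k <= prob_of p s (joined_in s x y) w.

Lemma joined_in_depends s x y : depends_on [set e | e \in s] (joined_in s x y).
Proof. exact: joined_depends. Qed.

Lemma joined_in_increasing s x y : increasing (fun w => `[<joined_in s x y w>]%:R : R).
Proof. by move=> w w' ww; apply: indicator_le; apply: joined_mono; apply: restr_mono. Qed.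

Lemma connS p D D' x y k : D `<=` D' ->
  connected_with_prob p D x y k -> connected_with_prob p D' x y k.
Proof. by move=> DD [s sD hs]; exists s => // e /sD /DD. Qed.

Lemma conn_refl p D x : connected_with_prob p D x x 1.
Proof.
exists [::] => // w; rewrite /prob_of /=; case: asboolP => // -[].
exact: joined_refl.
Qed.

Lemma conn_edge p D x y : adj x y -> (forall e : edge G, val e = [fset x; y]%fset -> D e) ->
  connected_with_prob p D x y p.
Proof.
move=> xy De; have [e exy] := edge_exists xy; exists [:: e].
  by move=> e'; rewrite inE => /eqP ->; apply: De.
move=> w; rewrite /prob_of /= /avg1.
have -> : `[< joined_in [:: e] x y (upd w e true) >].
  apply/asboolP; exists [:: y] => //=; rewrite andbT; apply/asboolP; exists e => //.
  by rewrite /restr /upd eqxx; apply/asboolP => /=; rewrite mem_head.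
case: asboolP => [[q pq lq]|_]; last by rewrite mulr1 mulr0 addr0.
case: q pq lq => [_ xE|z q /= /andP[/asboolP[e' _]]].
  by move: xy; rewrite -xE adj_irrefl.
by rewrite /restr /upd => /andP[+ /asboolP/=]; rewrite inE => + /eqP e'e; rewrite e'e eqxx.
Qed.

(** Both connections are increasing events, so that Harris' inequality applies. *)
Lemma conn_trans p D x y z k l : 0 <= p <= 1 -> 0 <= k -> 0 <= l ->
  connected_with_prob p D x y k -> connected_with_prob p D y z l ->
  connected_with_prob p D x z (k * l).
Proof.
move=> p01 k0 l0 [s sD hs] [t tD ht]; exists (s ++ t).
  by move=> e; rewrite mem_cat => /orP[/sD|/tD].
move=> w; rewrite /prob_of.
apply: (@le_trans _ _ (avg p (s ++ t)
   (fun w => `[<joined_in s x y w>]%:R * `[<joined_in t y z w>]%:R) w)); last first.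
  apply: avg_le => // v; rewrite indicator_mul; apply: indicator_le => -[sxy tyz].
  by apply: (joined_trans (y := y)); [apply: joinedS sxy|apply: joinedS tyz] => e /=;
    rewrite mem_cat => ->; rewrite ?orbT.
apply: le_trans (avg_harris _ _ p01 _ _); try exact: joined_in_increasing.
apply: ler_pM => //.
  rewrite avg_catC (avg_widen p t w w) //; first exact: hs.
  exact/indicator_depends/joined_in_depends.
rewrite (avg_widen p s w w) //; first exact: ht.
exact/indicator_depends/joined_in_depends.
Qed.

Lemma conn_map p (f : G -> G) (finj : injective f)
    (fadj : forall x y, adj x y -> adj (f x) (f y)) D D' x y k :
  0 <= p <= 1 -> (forall e, D e -> D' (edge_map fadj e)) ->
  connected_with_prob p D x y k -> connected_with_prob p D' (f x) (f y) k.
Proof.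
move=> p01 DD [s sD hs]; exists (map (edge_map fadj) s).
  by move=> _ /mapP[e /sD /DD + ->].
move=> w; have := hs (w \o edge_map fadj); move/le_trans; apply.
rewrite /prob_of -avg_map; last exact: edge_map_inj.
by apply: avg_le => // v; apply: indicator_le; apply: joined_map.
Qed.

Section Approximation.
Variables (p : R) (P : probability (config G) R).
Hypothesis hP : bernoulli_percolation p P.

Lemma joined_bigcup D x y : [set w : config G | joined (restr w D) x y] =
  \bigcup_m [set w | joined (restr w [set e | D e /\ e \in edge_prefix G m]) x y].
Proof.
apply/seteqP; split=> [w /joined_finite[m jm]|w [m _]].
  exists m => //=; move: jm; congr (joined _ _ _); apply/funext => e.
  by rewrite /restr asbool_and andbA.
by apply: joinedS => e [].
Qed.

Lemma joined_prefix_local D m x y : measurable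
  [set w : config G | joined (restr w [set e | D e /\ e \in edge_prefix G m]) x y].
Proof.
apply: (local_event hP (s := edge_prefix G m) (fun=> false) _).1.
by apply: depends_onS (@joined_depends G _ x y) => e [].
Qed.

Lemma joined_measurable D x y : measurable [set w : config G | joined (restr w D) x y].
Proof.
by rewrite joined_bigcup; apply: bigcup_measurable => m _; apply: joined_prefix_local.
Qed.

(** Continuity of the measure along the exhaustion by [edge_prefix]: a lower bound
    on a connection probability is witnessed by finitely many edges. *)
Lemma joined_approx x y k : k < fine (P [set w | joined w x y]) ->
  exists s : seq (edge G), forall w, k < prob_of p s (joined_in s x y) w.
Proof.
pose F m := [set w : config G | joined_in (edge_prefix G m) x y w].
have FE : [set w : config G | joined w x y] = \bigcup_m F m.
  apply/seteqP; split=> [w /joined_finite[m jm]|w [m _ /joined_restr//]].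
  by exists m.
have mF m : measurable (F m).
  by apply: (local_event hP (s := edge_prefix G m) (fun=> false) _).1; exact: joined_in_depends.
rewrite FE => kP.
have : P \o F @ \oo --> P (\bigcup_m F m).
  apply: nondecreasing_cvg_mu => //; first exact: bigcup_measurable.
  move=> m n mn; apply/subsetPset => w; apply: joinedS => e; exact: edge_prefixS.
have fin : P (\bigcup_m F m) \is a fin_num by apply: fin_num_measure; exact: bigcup_measurable.
rewrite -(fineK fin) => /fine_cvgP[_ cv].
have [m _ /(_ m (leqnn _)) /= km] : \forall m \near \oo, k < (fine \o (P \o F)) m.
  exact: cvgr_gt kP.
exists (edge_prefix G m) => w.
have [_ Pw] := local_event hP w (@joined_in_depends (edge_prefix G m) x y).
by move: km; rewrite [P _]Pw.
Qed.

End Approximation.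
End Connection.

(** * The regular tree *)

Section Tree.
Variable d : nat.
Implicit Types (a b c : 'I_d) (s t : seq 'I_d) (u v w y z : word d).

Local Notation reduced := (sorted [rel a b : 'I_d | a != b]).

Definition to_word s (red : reduced s) : word d := exist (fun s => reduced s) s red.

Definition descends u y : bool := suffix (val u) (val y).

Lemma foldr_flip_cat t s : reduced (t ++ s) -> foldr (@flip_letter d) s t = t ++ s.
Proof.
elim: t => [|a t IH] //= red; rewrite IH ?(path_sorted red)//.
by case: (t ++ s) red => [|b r] //= /andP[/negbTE ->].
Qed.

Lemma foldr_flip_rev s t : foldr (@flip_letter d) (rev s ++ t) s = t.
Proof.
elim/last_ind: s => [|s a IH] //=.
by rewrite rev_rcons foldr_rcons /= eqxx IH.
Qed.

(** Acting on [t] by the letters of [s] only alters the [size s] most recent letters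
    of [t]; this is what confines the translate of a ball. *)
Lemma foldr_flip_shape s t : exists x j,
  foldr (@flip_letter d) t s = x ++ drop j t /\ (j + size x <= size s)%N.
Proof.
elim: s => [|a s [x [j [E jx]]]] /=; first by exists [::], 0%N; rewrite drop0.
rewrite E {E}.
case: x jx => [|b x] /= jx; last first.
  by case: eqVneq => _; [exists x, j|exists [:: a, b & x], j]; split => //=; lia.
case dt: (drop j t) => [|b r] /=.
  by exists [:: a], j; rewrite dt; split => //=; lia.
case: eqVneq => _; last by exists [:: a], j; rewrite dt; split => //=; lia.
exists [::], j.+1; split => /=; last by lia.
by rewrite -addn1 addnC -drop_drop dt drop1.
Qed.

Lemma foldr_flip_reduced s t : reduced t -> reduced (foldr (@flip_letter d) t s).
Proof. by move=> redt; elim: s => [|a s IH] //=; apply: flip_letter_reduced. Qed.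

Lemma flip_letterK a s : reduced s -> flip_letter a (flip_letter a s) = s.
Proof.
case: s => [|b s] /=; first by rewrite eqxx.
case: eqVneq => [<-|_ _ /=]; last by rewrite eqxx.
by case: s => [|e s] //= /andP[/negbTE ->].
Qed.

Lemma tree_adj_flip u v : tree_adj u v <-> exists a, v = flip u a.
Proof.
have [s _ [_ /(_ v) sE]] := regular_tree_regular u.
split; last first.
  move=> [a ->]; rewrite /tree_adj /child /=; case: (val u) => [|c r] //=.
  by case: (eqVneq a c) => [_|ac] /=; rewrite ?eqxx ?orbT.
rewrite /tree_adj /child => /orP[]/andP[].
  case hv: (val v) (valP v) => [|a r] // + _ /= /eqP rE; rewrite {r}rE in hv * => red.
  exists a; apply: val_inj; rewrite hv /=; case: (val u) red => [|c r] //= /andP[ac _].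
  by rewrite (negbTE ac).
case hu: (val u) => [|c r] // _ /= /eqP rE; exists c.
by apply: val_inj; rewrite /= hu /= eqxx rE.
Qed.

(** Right translation by [u] in the free product of d copies of Z/2, whose Cayley
    graph for left multiplication by the generators is the tree. *)
Definition right_mul u w : word d := foldr (fun a v => flip v a) u (val w).

Lemma val_right_mul u w : val (right_mul u w) = foldr (@flip_letter d) (val u) (val w).
Proof. by rewrite /right_mul; elim: (val w) => [|a s IH] //=; rewrite IH. Qed.

Lemma right_mul_flip u w a : right_mul u (flip w a) = flip (right_mul u w) a.
Proof.
apply: val_inj; rewrite /= !val_right_mul /=.
case: (val w) => [|b s] //=; case: eqVneq => [<-|] //=.
by rewrite flip_letterK //; exact: foldr_flip_reduced (valP u).
Qed.

Lemma right_mul_adj u v w : tree_adj v w -> tree_adj (right_mul u v) (right_mul u w).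
Proof.
by move=> /tree_adj_flip[a ->]; apply/tree_adj_flip; exists a; rewrite right_mul_flip.
Qed.

Lemma right_mul_fold u v s :
  right_mul u (foldr (fun a v => flip v a) v s) = foldr (fun a v => flip v a) (right_mul u v) s.
Proof. by elim: s => [|a s IH] //=; rewrite right_mul_flip IH. Qed.

(** Left inverse: translation by the reversed word. *)
Lemma right_mul_inj u : injective (right_mul u).
Proof.
have red : reduced (rev (val u)).
  by rewrite rev_sorted; have := valP u; apply: sub_sorted => a b; rewrite /= eq_sym.
pose u' : word d := to_word red.
apply: (can_inj (g := right_mul u')) => w.
rewrite [right_mul u w]/right_mul right_mul_fold.
apply: val_inj; rewrite -[foldr _ _ _]/(right_mul (right_mul u' u) w) val_right_mul val_right_mul /=.
rewrite -[rev _]cats0 foldr_flip_rev foldr_flip_cat cats0 //; exact: (valP w).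
Qed.

(** * Root-preserving automorphisms of the tree *)

(** The automorphism that exchanges the branches at the children [b :: t] and
    [c :: t] of [t]: the letter placed just after a word is transposed exactly
    when that word lies in the cone of [t]. *)
Definition swap_above t b c s : seq 'I_d :=
  (fix loop s := if s is a :: r then
     (if suffix t r then tperm b c a else a) :: loop r else [::]) s.

Definition rooted_auto (f : seq 'I_d -> seq 'I_d) :=
  [/\ forall s, size (f s) = size s, forall s, behead (f s) = f (behead s),
      injective f & forall s, reduced s -> reduced (f s)].

(** Reducedness could only break at [t] itself, where the letter below is [ohead t];
    this letter is fixed by the transposition. *)
Lemma swap_above_rooted t b c :
  b != c -> (forall e, ohead t = Some e -> (b != e) && (c != e)) ->
  rooted_auto (swap_above t b c).
Proof.
move=> bc tbc; split.
- by elim=> [|a s IH] //=; rewrite IH.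
- by case.
- elim=> [|a s IH] [|a' s'] //= [E /IH ss]; rewrite ss in E *; congr (_ :: _).
  by move: E; case: ifP => // _ /perm_inj.
- case=> // a s; elim: s a => [|e s IH] //= a /andP[ae red].
  apply/andP; split; last exact: (IH e red).
  case: (boolP (suffix t s)) => ts.
    by rewrite (suffix_trans ts (suffix_suffix [:: e] s)) (inj_eq perm_inj).
  case: ifP => // /suffixP[[|x r] E]; last first.
    by case: E ts => _ ->; rewrite suffix_suffix.
  have /andP[be ce] : (b != e) && (c != e) by apply: tbc; rewrite -[t]E.
  by rewrite -[X in _ != X](tpermD be ce) (inj_eq perm_inj).
Qed.

Lemma swap_above_small t b c s : (size s <= size t)%N -> swap_above t b c s = s.
Proof.
elim: s => [|a s IH] //= st; rewrite IH ?(ltnW st)//.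
by rewrite ifN //; apply/negP => /size_suffix; rewrite leqNgt st.
Qed.

Lemma rooted_comp f g : rooted_auto f -> rooted_auto g -> rooted_auto (g \o f).
Proof.
move=> [f1 f2 f3 f4] [g1 g2 g3 g4]; split => [s|s|s s' /g3/f3//|s /f4/g4//] /=.
  by rewrite g1.
by rewrite g2 f2.
Qed.

(** Spherical symmetry: correct the image one letter at a time, from the root. *)
Lemma rooted_transitive s t : reduced s -> reduced t -> size s = size t ->
  exists2 f, rooted_auto f & f s = t.
Proof.
elim: s t => [|a s IH] [|b t] //=; first by move=> _ _ _; exists id; [split|].
move=> rs rt [st]; have [f [f1 f2 f3 f4] fs] := IH t (path_sorted rs) (path_sorted rt) st.
have [c fE] : exists c, f (a :: s) = c :: t.
  have := f1 (a :: s); have := f2 (a :: s).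
  by case: (f (a :: s)) => [|c r] //= -> _; exists c; rewrite fs.
have red : reduced (c :: t) by rewrite -fE; apply: f4.
have [bc|bc] := eqVneq b c; first by exists f; rewrite ?bc.
exists (swap_above t b c \o f).
  apply: rooted_comp => //; apply: swap_above_rooted => // e.
  by case: t rt red {IH fs st fE} => [|x t] //= /andP[bx _] /andP[cx _] [<-]; rewrite bx cx.
by rewrite /= fE /= suffix_refl tpermR swap_above_small.
Qed.

(** Compose a rooted automorphism that sends [v] to the word leading from [u] to [y]
    with the translation by [u]. The last clause says that the image of a ball of
    radius [r] around the root stays in the cone of the [r]-th ancestor of [u]. *)
Lemma tree_symmetry u v y : descends u y -> size (val y) = (size (val v) + size (val u))%N ->
  exists f : word d -> word d, [/\ injective f,
    forall w w', tree_adj w w' -> tree_adj (f w) (f w'),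
    f (tree_root d) = u, f v = y &
    forall w r, (size (val w) <= r)%N ->
      suffix (drop r (val u)) (val (f w)) /\ (size (val (f w)) <= size (val u) + r)%N].
Proof.
move=> /suffixP[t yE] sy.
have red : reduced (t ++ val u) by rewrite -yE; exact: (valP y).
have redt : reduced t by exact: (cat_sorted2 red).1.
have [f [f1 f2 f3 f4] fv] : exists2 f, rooted_auto f & f (val v) = t.
  apply: rooted_transitive => //; first exact: (valP v).
  by move: sy; rewrite yE size_cat => /addIn.
pose F w : word d := to_word (f4 _ (valP w)).
exists (right_mul u \o F); split.
- apply: inj_comp; first exact: right_mul_inj.
  by move=> w w' /(congr1 val) /= /f3 /val_inj.
- move=> w w' ww /=; apply: right_mul_adj.
  have Fchild z z' : child z z' -> child (F z) (F z').
    rewrite /child /= f2 => /andP[z'0 /eqP ->]; rewrite eqxx andbT.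
    by rewrite -size_eq0 f1 size_eq0.
  by move: ww; rewrite /tree_adj => /orP[/Fchild ->|/Fchild ->]; rewrite ?orbT.
- rewrite /=; apply: val_inj; rewrite val_right_mul /=.
  by have /size0nil -> : size (f [::]) = 0%N by rewrite f1.
- by apply: val_inj; rewrite val_right_mul /= fv foldr_flip_cat.
- move=> w r wr; rewrite /= val_right_mul /=.
  have [x [j [-> jx]]] := foldr_flip_shape (f (val w)) (val u); rewrite f1 in jx.
  have jr : (j <= r)%N by lia.
  split; last by rewrite size_cat size_drop addnC leq_add ?leq_subr //; lia.
  rewrite -(subnK jr) -drop_drop; apply: suffix_trans (suffix_suffix _ _).
  exact: suffix_drop.
Qed.

(** * Ancestors and descendants *)

Definition anc j y : word d := to_word (drop_sorted j (valP y)).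

Lemma size_anc j y : size (val (anc j y)) = (size (val y) - j)%N.
Proof. exact: size_drop. Qed.

Lemma anc_anc i j y : anc i (anc j y) = anc (i + j) y.
Proof. by apply: val_inj; rewrite /= drop_drop. Qed.

Lemma anc_adj y : (0 < size (val y))%N -> tree_adj (anc 1 y) y.
Proof.
by move=> y0; rewrite /tree_adj /child /= drop1 eqxx andbT -size_eq0 -lt0n y0.
Qed.

Lemma descends_refl u : descends u u.
Proof. exact: suffix_refl. Qed.

Lemma descends_trans u v w : descends u v -> descends v w -> descends u w.
Proof. exact: suffix_trans. Qed.

Lemma anc_descends j y : descends (anc j y) y.
Proof. exact: suffix_drop. Qed.

Lemma descends_anc u y : descends u y -> u = anc (size (val y) - size (val u)) y.
Proof.
by move=> /suffixP[t yE]; apply: val_inj; rewrite /= yE size_cat addnK drop_size_cat.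
Qed.

Lemma descends_anc_le u y j : descends u y -> (size (val u) + j <= size (val y))%N ->
  descends u (anc j y).
Proof.
move=> /suffixP[t yE]; rewrite /descends /= yE size_cat addnC leq_add2r => jt.
have [->|jt'] := eqVneq j (size t); first by rewrite drop_size_cat ?suffix_refl.
by rewrite drop_cat ltn_neqAle jt jt' suffix_suffix.
Qed.

Lemma descends_size u y : descends u y -> (size (val u) <= size (val y))%N.
Proof. exact: size_suffix. Qed.

Lemma descends_eq u v y : descends u y -> descends v y ->
  size (val u) = size (val v) -> u = v.
Proof. by move=> uy vy uv; rewrite (descends_anc uy) [RHS](descends_anc vy) uv. Qed.

(** * Enumeration of the descendants *)

Definition sons u : seq (word d) :=
  [seq flip u a | a <- enum 'I_d & ohead (val u) != Some a].

Fixpoint offspring n u : seq (word d) :=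
  if n is m.+1 then flatten [seq sons y | y <- offspring m u] else [:: u].

Lemma val_son u a : ohead (val u) != Some a -> val (flip u a) = a :: val u.
Proof.
rewrite /=; case: (val u) => [|b s] //= ba; rewrite ifN //.
by apply: contraNneq ba => ->.
Qed.

Lemma mem_sons u y : (y \in sons u) = child u y.
Proof.
apply/mapP/idP => [[a]|].
  by rewrite mem_filter => /andP[ha _] ->; rewrite /child val_son //= eqxx.
rewrite /child; case yE: (val y) (valP y) => [|a s] //= red /eqP sE.
have {}sE : val u = s by exact: esym sE.
have ha : ohead (val u) != Some a.
  by rewrite sE; case: s red {yE sE} => [|b s] //= /andP[ab _]; apply: contraNneq ab => -[->].
exists a; first by rewrite mem_filter ha mem_enum.
by apply: val_inj; rewrite val_son // yE sE.
Qed.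

Lemma offspringP n u y :
  (y \in offspring n u) = descends u y && (size (val y) == (n + size (val u))%N).
Proof.
elim: n y => [|n IH] y.
  rewrite inE add0n; apply/eqP/andP => [->|[uy /eqP sy]].
    by rewrite descends_refl.
  by apply: esym; apply: descends_eq uy (descends_refl y) _.
apply/flattenP/andP => [[_ /mapP[z + ->]]|[uy /eqP sy]].
  rewrite IH mem_sons => /andP[uz /eqP sz] zy; split; last first.
    by rewrite (child_size zy) sz addSn.
  apply: descends_trans uz _; move: zy => /andP[_ /eqP zy].
  by rewrite /descends -zy -drop1 suffix_drop.
exists (sons (anc 1 y)); first apply: map_f.
  rewrite IH descends_anc_le ?sy //=; last by rewrite addn1 addSn ltnS leq_addl.
  by rewrite size_drop sy addSn subn1.
by rewrite mem_sons /child /= drop1 eqxx andbT -size_eq0 sy.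
Qed.

Lemma sons_uniq u : uniq (sons u).
Proof.
rewrite map_inj_in_uniq; first exact/filter_uniq/enum_uniq.
move=> a b.
rewrite !mem_filter => /andP[ha _] /andP[hb _] /(congr1 val).
by rewrite !val_son // => -[].
Qed.

Lemma flatten_sons_uniq (r : seq (word d)) : uniq r -> uniq (flatten [seq sons y | y <- r]).
Proof.
elim: r => [|u r IH] //= /andP[ur ru]; rewrite cat_uniq sons_uniq IH // andbT /=.
apply/hasPn => y /flattenP[_ /mapP[z zr ->]]; rewrite !mem_sons => zy; apply/negP => uy.
have zu : z = u.
  by apply: val_inj; case/andP: zy => _ /eqP <-; case/andP: uy => _ /eqP <-.
by rewrite -zu zr in ur.
Qed.

Lemma offspring_uniq n u : uniq (offspring n u).
Proof. by elim: n => [|n IH] //=; apply: flatten_sons_uniq. Qed.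

Lemma size_sons u : size (sons u) = if nilp (val u) then d else d.-1.
Proof.
rewrite size_map; case: (val u) => [|a s] /=.
  by rewrite (eq_filter (a2 := predT)) // filter_predT size_enum_ord.
have := cardC1 a; rewrite card_ord => <-; rewrite cardE enumT /enum_mem !size_filter.
by apply: eq_count => b; rewrite !inE eq_sym.
Qed.

Lemma size_flatten_sons (r : seq (word d)) : {in r, forall y, ~~ nilp (val y)} ->
  size (flatten [seq sons y | y <- r]) = (d.-1 * size r)%N.
Proof.
elim: r => [|y r IH] h; first by rewrite muln0.
rewrite /= size_cat IH ?mulnS ?size_sons ?(negbTE (h _ (mem_head _ _))) //.
by move=> z zr; apply: h; rewrite inE zr orbT.
Qed.

Lemma size_offspring n u : ~~ nilp (val u) -> size (offspring n u) = (d.-1 ^ n)%N.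
Proof.
move=> u0; elim: n => [|n IH] //=; rewrite size_flatten_sons ?IH ?expnS // => y.
rewrite offspringP => /andP[/descends_size uy _].
by rewrite /nilp -lt0n; apply: leq_trans uy; rewrite lt0n.
Qed.

Lemma size_offspring_root n : size (offspring n.+1 (tree_root d)) = (d * d.-1 ^ n)%N.
Proof.
elim: n => [|n IH]; first by rewrite /= cats0 size_sons muln1.
rewrite -[LHS]/(size (flatten [seq sons y | y <- offspring n.+1 (tree_root d)])).
rewrite size_flatten_sons ?IH ?expnS; first by rewrite mulnCA.
by move=> y; rewrite offspringP => /andP[_ /eqP]; rewrite /nilp => ->.
Qed.

End Tree.

(** * Connections inside slabs of cones *)

Section Slabs.
Variables (R : realType) (d : nat).
Local Notation G := (tree_line d).
Local Notation at0 u := ((u : regular_tree d, 0 : line) : tree_line d).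
Implicit Types (u v w y : word d) (p k : R) (e : edge G).

Definition height (z : G) : nat := size (val z.1).

Definition cone u : set (edge G) := [set e : edge G | forall z : G, z \in val e -> descends u z.1].

(** The part of the cone of [u] between the heights of [u] and of its descendants
    of generation [N]. The edges over the top level are left out: they belong to
    the slabs of these descendants, so that slabs of successive generations are
    disjoint. *)
Definition slab u N : set (edge G) := [set e : edge G |
  (forall z : G, z \in val e -> descends u z.1 /\ (height z <= size (val u) + N)%N) /\
  exists2 z : G, z \in val e & (height z < size (val u) + N)%N].

Definition low r : set (edge G) := [set e : edge G | forall z : G, z \in val e -> (height z <= r)%N].

Definition around r u : set (edge G) := [set e : edge G | forall z : G, z \in val e ->
  suffix (drop r (val u)) (val z.1) /\ (height z <= size (val u) + r)%N].

Lemma low_exists (s : seq (edge G)) : exists r, forall e, e \in s -> low r e.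
Proof.
elim: s => [|e s [r IH]]; first by exists 0%N.
have [x [y [_ exy]]] := edge_ends e.
exists (maxn (maxn (height x) (height y)) r) => e'; rewrite inE => /orP[/eqP ->|/IH lr] z.
  by rewrite exy !inE => /orP[] /eqP ->; rewrite !leq_max leqnn ?orbT.
by move=> /lr zr; rewrite leq_max zr orbT.
Qed.

Lemma conn_around p r v u y k : 0 <= p <= 1 ->
  connected_with_prob p (low r) (at0 (tree_root d)) (at0 v) k ->
  descends u y -> size (val y) = (size (val v) + size (val u))%N ->
  connected_with_prob p (around r u) (at0 u) (at0 y) k.
Proof.
move=> p01 cv uy sy; have [f [finj fadj froot fv fr]] := tree_symmetry uy sy.
pose F (z : G) : G := (f z.1, z.2).
have Finj : injective F by move=> [a i] [b j] [/finj -> ->].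
have Fadj x z : adj x z -> adj (F x) (F z).
  case: x z => [a i] [b j]; rewrite /adj /= /box_adj /= => /orP[/andP[ab ->]|/andP[/eqP -> ->]].
    by rewrite (fadj _ _ ab).
  by rewrite eqxx orbT.
have -> : at0 u = F (at0 (tree_root d)) by rewrite /F /= froot.
have -> : at0 y = F (at0 v) by rewrite /F /= fv.
apply: (conn_map Finj (fadj := Fadj)) cv => // e le z /imfsetP[x /= /le xr ->].
exact: fr.
Qed.

(** Concatenate [K] translated copies of the connection from the root to [v]. A
    margin of [r] levels above [u] keeps all copies inside the cone of [u]. *)
Lemma conn_chain p r v u y k K : 0 <= p <= 1 -> 0 <= k ->
  connected_with_prob p (low r) (at0 (tree_root d)) (at0 v) k ->
  descends u y -> (size (val u) + K * size (val v) + r <= size (val y))%N ->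
  connected_with_prob p
    [set e : edge G | forall z : G, z \in val e -> descends u z.1 /\ (height z <= size (val y) + r)%N]
    (at0 (anc (K * size (val v)) y)) (at0 y) (k ^+ K).
Proof.
move=> p01 k0 cv uy; set n := size (val v); elim: K => [|K IH] sy.
  by rewrite mul0n (_ : anc 0 y = y); [exact: conn_refl|apply: val_inj; rewrite /= drop0].
rewrite exprS; apply: (conn_trans p01 k0) (IH _); first exact: exprn_ge0; last by rewrite mulSn in sy; lia.
rewrite mulSn -anc_anc; set x := anc (K * n) y.
have sx : size (val x) = (size (val y) - K * n)%N by rewrite size_anc.
rewrite mulSn in sy.
apply: connS (conn_around p01 cv (anc_descends n x) _); last by rewrite size_anc -/n; lia.
move=> e h z /h[rz]; rewrite size_anc => zr; split; last by lia.
have du : descends u (anc (r + n + K * n) y) by apply: descends_anc_le => //; lia.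
by apply: descends_trans du _; rewrite -addnA -2!anc_anc.
Qed.

(** Follow the geodesic of the tree, at the cost of a factor [p] per step. *)
Lemma conn_straight p u y j : 0 <= p <= 1 -> descends u y ->
  (size (val u) + j <= size (val y))%N ->
  connected_with_prob p [set e : edge G | (forall z : G, z \in val e ->
        descends u z.1 /\ (height z <= size (val y))%N) /\
      exists2 z : G, z \in val e & (height z < size (val y))%N]
    (at0 (anc j y)) (at0 y) (p ^+ j).
Proof.
move=> p01 uy; case/andP: (p01) => p0 p1; elim: j => [|j IH] sy.
  by rewrite (_ : anc 0 y = y); [exact: conn_refl|apply: val_inj; rewrite /= drop0].
rewrite exprS; apply: (conn_trans p01 p0) (IH _); first exact: exprn_ge0; last by lia.
rewrite -add1n -anc_anc; set x := anc j y.
have sx : size (val x) = (size (val y) - j)%N by rewrite size_anc.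
have dx : descends u x by apply: descends_anc_le => //; lia.
have sx1 : size (val (anc 1 x)) = (size (val x)).-1 by rewrite size_anc subn1.
apply: conn_edge => [|e ee].
  by rewrite /adj /= /box_adj /= (_ : tree_adj _ _) ?eqxx //; apply: anc_adj; lia.
split; last by exists (at0 (anc 1 x)); rewrite ?ee ?inE ?eqxx // /height [in X in (X < _)%N]sx1; lia.
move=> z; rewrite ee !inE => /orP[] /eqP ->; split; rewrite /height.
- by apply: descends_anc_le => //; lia.
- by rewrite sx1; lia.
- exact: dx.
- by rewrite sx; lia.
Qed.

(** The copies near the two ends could leave the slab. They are replaced by straight
    pieces of [M] steps, whose cost does not depend on [K]; with [r < M] the
    copies in between cannot get out. *)
Lemma conn_slab p r v u y k K M : 0 <= p <= 1 -> 0 <= k -> (r < M)%N ->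
  connected_with_prob p (low r) (at0 (tree_root d)) (at0 v) k ->
  descends u y -> size (val y) = (M + K * size (val v) + M + size (val u))%N ->
  connected_with_prob p (slab u (M + K * size (val v) + M)) (at0 u) (at0 y)
    (p ^+ M * (k ^+ K * p ^+ M)).
Proof.
move=> p01 k0 rM cv uy; set n := size (val v); set N := (M + _ + M)%N => sy.
case/andP: (p01) => p0 p1.
pose y2 := anc M y; pose y1 := anc (K * n) y2.
have sy2 : size (val y2) = (size (val u) + M + K * n)%N by rewrite size_anc; lia.
have sy1 : size (val y1) = (size (val u) + M)%N by rewrite size_anc sy2; lia.
have uy2 : descends u y2 by apply: descends_anc_le => //; lia.
have uy1 : descends u y1 by apply: descends_anc_le => //; lia.
have uE : u = anc M y1.
  by rewrite {1}(descends_anc uy1) sy1 addnC addnK.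
have nonempty e : exists z : G, z \in val e.
  by have [x [z [_ ->]]] := edge_ends e; exists x; rewrite !inE eqxx.
apply: (conn_trans (y := at0 y1)) => //; rewrite ?mulr_ge0 ?exprn_ge0 //.
  rewrite {2}uE; apply: connS (conn_straight p01 uy1 _); last by rewrite sy1.
  move=> e [h [z ze hz]]; split; last by exists z => //; lia.
  by move=> x /h[ux xy]; split=> //; lia.
apply: (conn_trans (y := at0 y2)) => //; rewrite ?exprn_ge0 //.
  apply: connS (conn_chain p01 k0 cv uy2 _); last by rewrite sy2; lia.
  move=> e h; split; last by have [z ze] := nonempty e; exists z => //; have [_] := h z ze; lia.
  by move=> x /h[ux xy]; split=> //; lia.
apply: connS (conn_straight p01 uy _); last by lia.
move=> e [h [z ze hz]]; split; last by exists z => //; lia.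
by move=> x /h[ux xy]; split=> //; lia.
Qed.

Lemma slab_cone u N : slab u N `<=` cone u.
Proof. by move=> e [h _] z /h[]. Qed.

Lemma coneS u y : descends u y -> cone y `<=` cone u.
Proof. by move=> uy e h z /h; apply: descends_trans. Qed.

Lemma slab_cone_disjoint u N y e : size (val y) = (N + size (val u))%N ->
  cone y e -> ~ slab u N e.
Proof. by move=> sy h [_ [z /h /descends_size yz]]; rewrite ltnNge addnC -sy yz. Qed.

Lemma cone_disjoint y y' e : size (val y) = size (val y') ->
  cone y e -> cone y' e -> y = y'.
Proof.
have [x [z [_ exz]]] := edge_ends e => syy h h'.
have xe : x \in val e by rewrite exz !inE eqxx.
exact: descends_eq (h x xe) (h' x xe) syy.
Qed.

End Slabs.

(** * The embedded branching process *)

(** The probability that no line survives is a product of this form. The second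
    order Bonferroni bound [1 - s + s ^ 2 / 2], for [s = c * sum], is stable under
    multiplication by [1 - y], and [s <= 1] absorbs the quadratic term. *)
Lemma prod_one_sub_le (R : realFieldType) (I : eqType) (r : seq I) (c : R) (x : I -> R) :
  0 <= c -> c * (size r)%:R <= 1 -> (forall i, 0 <= x i <= 1) ->
  \prod_(i <- r) (1 - c * x i) <= 1 - c / 2 * \sum_(i <- r) x i.
Proof.
move=> c0 cr x01.
have xr : \sum_(i <- r) x i <= (size r)%:R.
  elim: r {cr} => [|i r IH]; first by rewrite big_nil.
  by rewrite big_cons /= -natr1 addrC lerD //; case/andP: (x01 i).
have x0 : 0 <= \sum_(i <- r) x i by apply: sumr_ge0 => i _; case/andP: (x01 i).
have c1 : forall i, i \in r -> c * x i <= 1.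
  move=> i ir; apply: le_trans cr; apply: ler_wpM2l => //.
  case/andP: (x01 i) => _ /le_trans; apply; rewrite ler1n.
  by case: r ir {xr x0}.
have : \prod_(i <- r) (1 - c * x i) <=
    1 - c * (\sum_(i <- r) x i) + (c * \sum_(i <- r) x i) ^+ 2 / 2.
  elim: r c1 {cr xr x0} => [|i r IH] c1; first by rewrite !big_nil; lra.
  rewrite !big_cons.
  have y1 : 0 <= 1 - c * x i by rewrite subr_ge0 c1 ?mem_head.
  have {}IH := IH (fun j jr => c1 j (mem_behead (s := i :: r) jr)).
  apply: le_trans (ler_wpM2l y1 IH) _.
  have s0 : 0 <= \sum_(j <- r) x j by apply: sumr_ge0 => j _; case/andP: (x01 j).
  have [xi0 _] := andP (x01 i).
  move: (\sum_(j <- r) x j) s0 (x i) xi0 {y1 IH c1} => s s0 y y0.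
  have cy : 0 <= c * y by rewrite mulr_ge0.
  have h1 : 0 <= (c * y) ^+ 2 by rewrite sqr_ge0.
  have h2 : 0 <= (c * y) * (c * s) ^+ 2 by rewrite mulr_ge0 ?sqr_ge0.
  rewrite -subr_ge0; have -> : 1 - c * (y + s) + (c * (y + s)) ^+ 2 / 2 -
    (1 - c * y) * (1 - c * s + (c * s) ^+ 2 / 2) =
    (c * y) ^+ 2 / 2 + (c * y) * (c * s) ^+ 2 / 2 by field.
  by apply: addr_ge0; rewrite divr_ge0.
move=> /le_trans; apply; move: (\sum_(i <- r) x i) xr x0 => s sr s0.
have cs1 : c * s <= 1 by apply: le_trans cr; apply: ler_wpM2l.
have cs0 : 0 <= c * s by rewrite mulr_ge0.
have : (c * s) ^+ 2 <= c * s by rewrite expr2 ler_piMl.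
by rewrite [c / 2 * s]mulrAC; move: (c * s) => t; lra.
Qed.

Section Branching.
Variables (R : realType) (d : nat).
Local Notation G := (tree_line d).
Local Notation at0 u := ((u : regular_tree d, 0 : line) : tree_line d).
Implicit Types (u v y : word d) (w : config G) (e : edge G).

(** The cluster of [u] inside the cone of [u] contains a vertex of the tree [m]
    levels further from the root. *)
Definition reaches m (w : config G) u : Prop := exists y,
  (size (val u) + m <= size (val y))%N /\ joined (restr w (cone u)) (at0 u) (at0 y).

Variables (p k : R) (N : nat).
Hypothesis p01 : 0 <= p <= 1.
Hypothesis d3 : (3 <= d)%N.
Hypothesis N0 : (0 < N)%N.
Hypothesis slab_conn : forall u y, y \in offspring N u ->
  connected_with_prob p (slab u N) (at0 u) (at0 y) k.
Hypothesis k_large : 2 <= k * (d.-1 ^ N)%:R.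

Let c : R := ((d.-1 ^ N)%:R)^-1.

Lemma branch_gt0 : 0 < (d.-1 ^ N)%:R :> R.
Proof. by rewrite ltr0n expn_gt0; case: (d) d3 => [|[|]]. Qed.

(** A Galton-Watson process with [1 / c] potential children per vertex, each present with
    probability [k], hence with mean at least 2. If every child has a surviving
    line with probability at least [c], then the expected number of such lines
    is at least [2 c], and the previous product bound gives one with probability
    at least [c]: the bound [c] is stable from one generation to the next. The
    event is given through a local event that implies it. *)
Lemma reach_with_prob m u : ~~ nilp (val u) ->
  exists t : seq (edge G) * (config G -> Prop),
    [/\ forall e, e \in t.1 -> cone u e, depends_on [set e | e \in t.1] t.2,
      forall w, c <= prob_of p t.1 t.2 w & forall w, t.2 w -> reaches m w u].
Proof.
have c0 : 0 <= c by rewrite invr_ge0 ltW // branch_gt0.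
elim: m u => [|m IH] u u0.
  exists ([::], fun=> True); split=> // [w|w _].
    rewrite /prob_of /= asboolT // /c invf_le1 ?branch_gt0 // ler1n.
    by rewrite expn_gt0; case: (d) d3 => [|[|]].
  by exists u; rewrite addn0; split=> //; exact: joined_refl.
set r := offspring N u.
have rP y : y \in r -> descends u y /\ size (val y) = (N + size (val u))%N.
  by rewrite offspringP => /andP[? /eqP].
have ry0 y : y \in r -> ~~ nilp (val y).
  by move=> /rP[/descends_size uy _]; move: u0; rewrite /nilp -!lt0n => /leq_trans; apply.
have [sC hC] : {sC : word d -> seq (edge G) & forall y, y \in r ->
    (forall e, e \in sC y -> slab u N e) /\
    forall w, k <= prob_of p (sC y) (joined_in (sC y) (at0 u) (at0 y)) w}.
  apply: (@choice _ _ (fun (y : word d) (s : seq (edge G)) => y \in r -> (forall e, e \in s -> slab u N e) /\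
    forall w, k <= prob_of p s (joined_in s (at0 u) (at0 y)) w)) => y.
  case: (boolP (y \in r)) => [/slab_conn[s s1 s2]|_]; last by exists [::].
  by exists s.
have [T hT] : {T : word d -> seq (edge G) * (config G -> Prop) & forall y, y \in r ->
    [/\ forall e, e \in (T y).1 -> cone y e, depends_on [set e | e \in (T y).1] (T y).2,
      forall w, c <= prob_of p (T y).1 (T y).2 w & forall w, (T y).2 w -> reaches m w y]}.
  apply: (@choice _ _ (fun (y : word d) (t : seq (edge G) * (config G -> Prop)) => y \in r -> [/\ forall e, e \in t.1 -> cone y e,
     depends_on [set e | e \in t.1] t.2,
      forall w, c <= prob_of p t.1 t.2 w & forall w, t.2 w -> reaches m w y])) => y.
  case: (boolP (y \in r)) => [yr|_]; last by exists ([::], fun=> True).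
  by have [t] := IH y (ry0 y yr); exists t.
pose C y (w : config G) : R := `[<joined_in (sC y) (at0 u) (at0 y) w>]%:R.
pose a y (w : config G) : R := `[<(T y).2 w>]%:R.
pose SC := flatten [seq sC y | y <- r]; pose SA := flatten [seq (T y).1 | y <- r].
pose A (w : config G) : Prop :=
  exists y, [/\ y \in r, joined_in (sC y) (at0 u) (at0 y) w & (T y).2 w].
have SCP e : e \in SC -> slab u N e.
  by move=> /flattenP[_ /mapP[y yr ->]]; apply: (hC y yr).1.
have sCS y : y \in r -> {subset sC y <= SC}.
  by move=> yr e ey; apply/flattenP; exists (sC y) => //; apply: map_f.
have sAS y : y \in r -> {subset (T y).1 <= SA}.
  by move=> yr e ey; apply/flattenP; exists (T y).1 => //; apply: map_f.
have SAP e : e \in SA -> exists2 y, y \in r & cone y e.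
  by move=> /flattenP[_ /mapP[y yr ->]] ey; exists y => //; case: (hT y yr) => + _ _ _; apply.
exists (SC ++ SA, A); split => /=.
- move=> e; rewrite mem_cat => /orP[/SCP/slab_cone//|/SAP[y /rP[uy _]]].
  exact: coneS.
- move=> w w' ww; apply/propext; split=> -[y [yr jy Ty]]; exists y; split=> //.
  + rewrite -(@joined_in_depends _ (sC y) _ _ w w') // => e ey.
    by apply: ww; rewrite /= mem_cat (sCS _ yr).
  + case: (hT y yr) => _ dep _ _; rewrite -(dep w w') // => e ey.
    by apply: ww; rewrite /= mem_cat (sAS _ yr) ?orbT.
  + rewrite (@joined_in_depends _ (sC y) _ _ w w') // => e ey.
    by apply: ww; rewrite /= mem_cat (sCS _ yr).
  + case: (hT y yr) => _ dep _ _; rewrite (dep w w') // => e ey.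
    by apply: ww; rewrite /= mem_cat (sAS _ yr) ?orbT.
- move=> w.
  (* inclusion-exclusion in product form, before integrating out the lines *)
  have AE : (fun w : config G => `[<A w>]%:R : R) =
      (fun w => 1 + (-1) * \prod_(y <- r) (1 - C y w * a y w)).
    apply/funext => v; case: asboolP => [[y [yr jy Ty]]|nA].
      by rewrite (big_rem y) //= /C /a !asboolT // mulr1 subrr mul0r mulr0 addr0.
    rewrite big_seq big1 ?mulr1 ?subrr // => y yr.
    rewrite /C /a indicator_mul asboolF ?subr0 // => -[jy Ty]; apply: nA; by exists y.
  have slice w0 : avg p SA (fun w => `[<A w>]%:R : R) =
      fun w => 1 + (-1) * \prod_(y <- r) (1 - C y w * avg p (T y).1 (a y) w0).
    rewrite AE; apply/funext => v; rewrite avgD avg_cst avgZ; congr (1 + -1 * _).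
    rewrite (@avg_branching _ _ p _ r (fun y => (T y).1) C a [set e | e \in SC] w0) //.
    - exact: offspring_uniq.
    - move=> y yr; apply: depends_onS (sCS y yr) _.
      exact/indicator_depends/joined_in_depends.
    - move=> y e yr ey /= eSC; case: (hT y yr) => cy _ _ _.
      by apply: (slab_cone_disjoint (rP y yr).2 (cy e ey)); exact: SCP.
    - by move=> y yr; case: (hT y yr) => _ dep _ _; apply: indicator_depends.
    - move=> y y' e yr yr' yy ey; apply/negP => ey'; case/eqP: yy.
      case: (hT y yr) => /(_ e ey) cy _ _ _; case: (hT y' yr') => /(_ e ey') cy' _ _ _.
      by apply: cone_disjoint cy cy'; rewrite (rP y yr).2 (rP y' yr').2.
  rewrite /prob_of avg_cat (slice w).
  apply: (@le_trans _ _ (avg p SC (fun w => c / 2 * \sum_(y <- r) C y w) w)).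
    rewrite avgZ avg_sum big_seq.
    apply: (@le_trans _ _ (c / 2 * \sum_(y <- r | y \in r) k)).
      rewrite -big_seq big_const_seq count_predT iter_addr addr0 size_offspring //.
      rewrite -[leLHS]mulr1 -mulrA; apply: ler_wpM2l => //.
      by rewrite -mulr_natr; move: k_large; lra.
    apply: ler_wpM2l; first by rewrite divr_ge0.
    apply: ler_sum => y yr; rewrite (avg_subset p w w _ (sCS y yr)); first exact: (hC y yr).2.
    exact/indicator_depends/joined_in_depends.
  apply: avg_le => // v; rewrite mulN1r lerBrDl -lerBrDr.
  apply: (@le_trans _ _ (\prod_(y <- r) (1 - c * C y v))).
    rewrite !big_seq; apply: ler_prod => y yr; case: (hT y yr) => _ _ cT _.
    have c1 := cT w; rewrite /C; case: (asbool _); rewrite ?mul0r ?mulr0 ?subr0 ?lexx ?ler01 //.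
    rewrite mul1r mulr1 subr_ge0 lerB // andbT.
    rewrite -(avg_cst p (T y).1 1 w); apply: avg_le => // x.
    by rewrite lern1; case: (asbool _).
  apply: prod_one_sub_le => //.
    by rewrite size_offspring // /c mulVf // gt_eqF // branch_gt0.
  by move=> y; rewrite ler0n lern1; case: (asbool _).
- move=> w [y [yr jy Ty]]; have [uy sy] := rP y yr.
  case: (hT y yr) => _ _ _ /(_ w Ty)[z [sz jz]]; exists z; split; first by lia.
  apply: (joined_trans (y := at0 y)).
    by apply: joinedS jy => e /(hC y yr).1/slab_cone.
  by apply: joinedS jz; exact: coneS.
Qed.

End Branching.

(** * Almost sure existence of an infinite cluster *)

Lemma geometric_le_eps (R : realType) (q eps : R) :
  0 <= q < 1 -> 0 < eps -> exists J, q ^+ J <= eps.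
Proof.
move=> /andP[q0 q1] e0.
have /cvgr_le/(_ _ e0)[J _ hJ] : (fun n => q ^+ n) @ \oo --> (0 : R).
  by apply: cvg_expr; rewrite ger0_norm.
by exists J; apply: hJ => /=.
Qed.

Section AlmostSure.
Variables (R : realType) (d : nat).
Local Notation G := (tree_line d).
Local Notation at0 u := ((u : regular_tree d, 0 : line) : tree_line d).
Implicit Types (u v y : word d) (w : config G) (e : edge G).

Lemma reachesS m n w u : (m <= n)%N -> reaches n w u -> reaches m w u.
Proof. by move=> mn [y [sy jy]]; exists y; split => //; lia. Qed.

(** A finite cluster has bounded height. *)
Lemma reaches_infinite w u : (forall m, reaches m w u) -> has_infinite_cluster w.
Proof.
move=> h; exists (at0 u) => /finite_seqP[s sE].
have [m hm] : exists m, forall z : G, z \in s -> (height z < m)%N.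
  elim: s {sE} => [|z s [m IH]]; first by exists 0%N.
  exists (maxn (height z).+1 m) => x; rewrite inE leq_max => /orP[/eqP ->|/IH ->].
    by rewrite leqnn.
  by rewrite orbT.
have [y [sy jy]] := h m.
have ys : at0 y \in s.
  suff : [set` s] (at0 y) by [].
  by rewrite -sE; apply: joined_restr jy.
by have := hm _ ys; rewrite /height ltnNge (leq_trans _ sy) ?leq_addl.
Qed.

Variables (p c : R) (P : probability (config G) R).
Hypothesis hP : bernoulli_percolation p P.
Hypothesis p01 : 0 <= p <= 1.
Hypothesis d3 : (3 <= d)%N.
Hypothesis c0 : 0 < c.
Hypothesis reach : forall m u, ~~ nilp (val u) ->
  exists t : seq (edge G) * (config G -> Prop),
    [/\ forall e, e \in t.1 -> cone u e, depends_on [set e | e \in t.1] t.2,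
      forall w, c <= prob_of p t.1 t.2 w & forall w, t.2 w -> reaches m w u].

Lemma reach_prob_le1 : c <= 1.
Proof.
have a0 : 'I_d by case: (d) d3 => [|n] // _; exact: ord0.
have [t [_ _ ct _]] := @reach 0%N (@to_word d [:: a0] isT) isT.
apply: le_trans (ct (fun=> false)) _.
rewrite -(avg_cst p t.1 1 (fun=> false)); apply: avg_le => // x.
by rewrite lern1; case: (asbool _).
Qed.

Lemma reaches_measurable m u : measurable [set w : config G | reaches m w u].
Proof.
pose F n : set (config G) := [set w | exists y, [/\ choice.unpickle n = Some y,
     (size (val u) + m <= size (val y))%N & joined (restr w (cone u)) (at0 u) (at0 y)]].
have -> : [set w : config G | reaches m w u] = \bigcup_n F n.
  apply/seteqP; split=> [w [y [sy jy]]|w [n _ [y [_ sy jy]]]]; last by exists y.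
  by exists (choice.pickle y) => //; exists y; rewrite choice.pickleK.
apply: bigcup_measurable => n _.
case nE: (choice.unpickle n : option (word d)) => [y|]; last first.
  by suff -> : F n = set0 by []; apply/seteqP; split=> // w [y []]; rewrite nE.
have [sy|sy] := leqP (size (val u) + m)%N (size (val y)); last first.
  suff -> : F n = set0 by []; apply/seteqP; split=> // w [y' []]; rewrite nE => -[<-].
  by rewrite leqNgt sy.
suff -> : F n = [set w | joined (restr w (cone u)) (at0 u) (at0 y)].
  exact: joined_measurable hP _ _ _.
apply/seteqP; split=> [w [y' []]|w jy]; first by rewrite nE => -[<-].
by exists y.
Qed.

(** The cones of the descendants of generation [J] are disjoint, and there are at
    least [J] of them. *)
Lemma none_reaches J m u0 : ~~ nilp (val u0) ->
  (P (\bigcap_(y in [set` offspring J u0]) ~` [set w : config G | reaches m w y])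
    <= ((1 - c) ^+ J)%:E)%E.
Proof.
move=> u00; set r := offspring J u0.
have rP y : y \in r -> descends u0 y /\ size (val y) = (J + size (val u0))%N.
  by rewrite offspringP => /andP[? /eqP].
have ry0 y : y \in r -> ~~ nilp (val y).
  by move=> /rP[/descends_size uy _]; move: u00; rewrite /nilp -!lt0n => /leq_trans; apply.
have [T hT] : {T : word d -> seq (edge G) * (config G -> Prop) & forall y, y \in r ->
    [/\ forall e, e \in (T y).1 -> cone y e, depends_on [set e | e \in (T y).1] (T y).2,
      forall w, c <= prob_of p (T y).1 (T y).2 w & forall w, (T y).2 w -> reaches m w y]}.
  apply: (@choice _ _ (fun (y : word d) (t : seq (edge G) * (config G -> Prop)) => y \in r ->
     [/\ forall e, e \in t.1 -> cone y e, depends_on [set e | e \in t.1] t.2,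
      forall w, c <= prob_of p t.1 t.2 w & forall w, t.2 w -> reaches m w y])) => y.
  case: (boolP (y \in r)) => [yr|_]; last by exists ([::], fun=> True).
  by have [t] := reach m (ry0 y yr); exists t.
pose a y (w : config G) : R := `[<(T y).2 w>]%:R.
pose SA := flatten [seq (T y).1 | y <- r].
pose B : config G -> Prop := fun w => forall y, y \in r -> ~ (T y).2 w.
have w0 : config G := fun=> false.
have dB : depends_on [set e | e \in SA] B.
  have sAS y : y \in r -> {subset (T y).1 <= SA}.
    by move=> yr e ey; apply/flattenP; exists (T y).1 => //; apply: map_f.
  move=> w w' ww; apply/propext; split=> h y yr; have := h y yr;
    case: (hT y yr) => _ dep _ _.
  - by rewrite (dep w w') // => e ey; apply: ww; exact: sAS ey.
  - by rewrite (dep w w') // => e ey; apply: ww; exact: sAS ey.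
have [mB PB] := local_event hP w0 dB.
apply: (@le_trans _ _ (P B)).
  apply: le_measure; rewrite ?inE //.
    apply: fin_bigcap_measurable => // y _; apply: measurableC.
    exact: reaches_measurable.
  move=> w h y yr Ty; apply: (h y yr).
  by case: (hT y yr) => _ _ _; apply.
rewrite PB lee_fin /prob_of.
have -> : (fun w : config G => `[<B w>]%:R : R) = fun w => \prod_(y <- r) (1 - 1 * a y w).
  apply/funext => w; case: asboolP => [Bw|nB].
    rewrite big_seq big1 // => y yr; rewrite /a asboolF ?mulr0 ?subr0 //; exact: Bw.
  have [y yr Ty] : exists2 y, y \in r & (T y).2 w.
    apply: contrapT => nT; apply: nB => y yr Ty; apply: nT; by exists y.
  by rewrite (big_rem y) //= /a asboolT // mulr1 subrr mul0r.
rewrite (@avg_branching _ _ p _ r (fun y => (T y).1) (fun _ _ => 1) a set0 w0) //; first last.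
- move=> y y' e yr yr' yy ey; apply/negP => ey'; case/eqP: yy.
  case: (hT y yr) => /(_ e ey) cy _ _ _; case: (hT y' yr') => /(_ e ey') cy' _ _ _.
  by apply: cone_disjoint cy cy'; rewrite (rP y yr).2 (rP y' yr').2.
- by move=> y yr; case: (hT y yr) => _ dep _ _; apply: indicator_depends.
- by move=> y e _ _ [].
- exact: offspring_uniq.
have aP y : y \in r -> c <= avg p (T y).1 (a y) w0 <= 1.
  move=> yr; case: (hT y yr) => _ _ cT _; rewrite [_ <= _](cT w0) /=.
  rewrite -(avg_cst p (T y).1 1 w0); apply: avg_le => // x.
  by rewrite lern1; case: (asbool _).
have Jr : (J <= size r)%N.
  by rewrite size_offspring // ltnW // ltn_expl //; case: (d) d3 => [|[|[|]]].
have c1 := reach_prob_le1.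
apply: (@le_trans _ _ ((1 - c) ^+ size r)).
  rewrite -[size r]count_predT -[leRHS]mulr1 -iter_mulr -big_const_seq !big_seq.
  by apply: ler_prod => y /aP/andP[h1 h2]; rewrite mul1r subr_ge0 h2 lerD2l lerN2 h1.
by apply: (ler_wiXn2l _ _ Jr); rewrite ?subr_ge0 // lerBlDr lerDl ltW.
Qed.

(** Without an infinite cluster, every vertex fails to reach some height, hence
    for each [J] all descendants of generation [J] fail to reach a common height.
    These events increase with the height and have probability at most
    [(1 - c) ^ J]. *)
Lemma infinite_cluster_ae : {ae P, forall w, has_infinite_cluster w}.
Proof.
have a0 : 'I_d by case: (d) d3 => [|n] // _; exact: ord0.
pose u0 : word d := @to_word d [:: a0] isT.
have u00 : ~~ nilp (val u0) by [].
pose N J m : set (config G) :=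
  \bigcap_(y in [set` offspring J u0]) ~` [set w : config G | reaches m w y].
have mN J m : measurable (N J m).
  apply: fin_bigcap_measurable => // y _; apply: measurableC; exact: reaches_measurable.
have mU J : measurable (\bigcup_m N J m) by apply: bigcup_measurable.
exists (\bigcap_J \bigcup_m N J m); split.
- by apply: bigcap_measurable.
- apply/eqP; rewrite -measure_le0; apply/lee_addgt0Pr => eps eps0; rewrite add0e.
  have [J hJ] : exists J, (1 - c) ^+ J <= eps by apply: geometric_le_eps => //; rewrite subr_ge0 reach_prob_le1 ltrBlDr ltrDl.
  apply: (@le_trans _ _ (P (\bigcup_m N J m))).
    apply: le_measure; rewrite ?inE //; first exact: bigcap_measurable.
    by move=> w; apply.
  apply: (@le_trans _ _ ((1 - c) ^+ J)%:E); last by rewrite lee_fin.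
  have cv : P \o N J @ \oo --> P (\bigcup_m N J m).
    apply: nondecreasing_cvg_mu => // m n mn; apply/subsetPset => w h y yr rn.
    by apply: (h y yr); apply: reachesS rn.
  rewrite -(cvg_lim _ cv) //; apply: lime_le; first by apply/cvg_ex; exists (P (\bigcup_m N J m)).
  by apply: nearW => m; exact: none_reaches.
- move=> w noinf J _.
  have nr y : exists m, ~ reaches m w y.
    apply: contrapT => h; apply: noinf; apply: (@reaches_infinite w y) => m.
    by apply: contrapT => hm; apply: h; exists m.
  have [f hf] := choice nr.
  exists (\max_(y <- offspring J u0) f y) => // y yr rm; apply: (hf y).
  by apply: reachesS rm; apply: leq_bigmax_seq.
Qed.

End AlmostSure.

(** * Growth rate *)

Section Growth.
Variables (R : realType) (d : nat).
Local Notation G := (tree_line d).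
Implicit Types (u v y : word d).

Lemma graph_ball_step (H : sgraph) (x y z : H) n :
  graph_ball x n y -> adj y z -> graph_ball x n.+1 z.
Proof.
move=> [q pq [lq sq]] yz; exists (rcons q z); first by rewrite rcons_path pq lq.
by rewrite last_rcons size_rcons.
Qed.

Lemma graph_ball_ind (H : sgraph) (x : H) (Q : nat -> H -> Prop) :
  Q 0%N x -> (forall n (y z : H), Q n y -> adj y z -> Q n.+1 z) ->
  (forall m n (y : H), (m <= n)%N -> Q m y -> Q n y) ->
  forall n (y : H), graph_ball x n y -> Q n y.
Proof.
move=> Q0 QS Qmono n y [q pq [<- sq]]; apply: (Qmono (size q)) => // {n sq y}.
elim/last_ind: q pq => [|q y IH] //; rewrite rcons_path last_rcons size_rcons.
by move=> /andP[/IH + ]; apply: QS.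
Qed.

Lemma offspring_ball n u y : y \in offspring n u -> graph_ball (u : regular_tree d) n y.
Proof.
elim: n y => [|n IH] y; first by rewrite inE => /eqP ->; exists [::].
move=> /flattenP[_ /mapP[z /IH uz ->]]; rewrite mem_sons => zy.
by apply: graph_ball_step uz _; rewrite /adj /= /tree_adj zy.
Qed.

Lemma at_distance_root v n : at_distance (tree_root d) v n -> size (val v) = n.
Proof.
move=> [bn mn]; apply/eqP; rewrite eqn_leq mn ?andbT; last first.
  by apply: offspring_ball; rewrite offspringP /descends suffix0s addn0 eqxx.
move: n v bn {mn}; apply: (@graph_ball_ind (regular_tree d) (tree_root d) (fun n (y : regular_tree d) => size (val y) <= n)%N).
- by [].
- move=> n y z yn; rewrite [adj _ _]/(tree_adj y z) => /orP[/child_size ->//|/child_size E].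
  by apply: leq_trans (leq_trans (leqnSn _) _) (leqnSn n); rewrite -E.
- by move=> m n y mn /leq_trans; apply.
Qed.

Definition words n : seq (word d) :=
  flatten [seq offspring m (tree_root d) | m <- iota 0 n.+1].

Lemma mem_words n y : (y \in words n) = (size (val y) <= n)%N.
Proof.
apply/flattenP/idP => [[_ /mapP[m + ->]]|yn].
  by rewrite mem_iota offspringP /= addn0 => mn /andP[_ /eqP ->].
exists (offspring (size (val y)) (tree_root d)).
  by apply/mapP; exists (size (val y)); rewrite // mem_iota.
by rewrite offspringP /descends suffix0s addn0 eqxx.
Qed.

Hypothesis d3 : (3 <= d)%N.

Lemma size_words n : (size (words n) <= n.+1 * (d * d.-1 ^ n))%N.
Proof.
rewrite size_flatten /shape -map_comp sumnE big_map.
rewrite -[X in (_ <= X * _)%N](size_iota 0) -sum1_size big_distrl.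
rewrite !big_seq; apply: leq_sum => m; rewrite mem_iota => /andP[_ mn]; rewrite /= mul1n.
case: m mn => [_|m mn]; first by rewrite /= muln_gt0 expn_gt0; case: (d) d3 => [|[|]].
rewrite size_offspring_root leq_mul2l leq_pexp2l ?orbT //; last by lia.
by case: (d) d3 => [|[|]].
Qed.

(** Right translation identifies the ball around [x.1] in the tree with the ball around
    the root, whose words have at most [n] letters. *)
Definition ball_cover (x : G) n : seq G :=
  [seq (right_mul x.1 w, x.2 + (i%:Z - n%:Z)) | w <- words n, i <- iota 0 (n + n).+1].

Lemma size_flip_letter (a : 'I_d) s : (size (flip_letter a s) <= (size s).+1)%N.
Proof. by case: s => [|b s] //=; case: ifP => _ //=; exact: leqW. Qed.

Lemma ball_coverP (x : G) n (y : G) : graph_ball x n y -> y \in ball_cover x n.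
Proof.
move=> b; have [w [k [wn kn ->]]] : exists (w : word d) (k : int), [/\ (size (val w) <= n)%N, `|k| <= n%:Z
    & y = (right_mul x.1 w, x.2 + k) :> G].
  move: n y b; apply: graph_ball_ind.
  - by exists (tree_root d), 0; split => //; rewrite addr0; case: x.
  - move=> n _ [z j] [w [k [wn kn ->]]].
    move=> /orP[/andP[/= /tree_adj_flip[a za] kjE]|/andP[/= zE kj]].
      have kj : x.2 + k = j by apply/eqP.
      exists (flip w a), k; split; [|lia|by rewrite right_mul_flip -za kj].
      exact: leq_trans (size_flip_letter a (val w)) _.
    have za : right_mul x.1 w = z by apply/eqP.
    exists w, (j - x.2); split; [exact: leqW| |by rewrite za addrC subrK].
    have lip (a b c : int) : `|a + c - b| == 1 -> `|c| <= n%:Z -> `|b - a| <= n.+1%:Z by lia.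
    exact: lip kj kn.
  - by move=> m n y mn [w [k [wm km ->]]]; exists w, k; split => //; lia.
apply/allpairsP; exists (w, absz (k + n%:Z)); split.
- by rewrite mem_words.
- have inr (c : int) : `|c| <= n%:Z -> (absz (c + n%:Z)%R < (n + n).+1)%N by lia.
  by rewrite mem_iota /= add0n; exact: inr.
- have shift (c : int) : `|c| <= n%:Z -> c = (absz (c + n%:Z)%R)%:Z - n%:Z by lia.
  by rewrite /= -(shift _ kn).
Qed.

Lemma ball_card_le (x : G) n :
  (#|` fset_set (graph_ball x n)| <= (n + n).+1 * (n.+1 * (d * d.-1 ^ n)))%N.
Proof.
apply: (@leq_trans (size (ball_cover x n))); last first.
  by rewrite size_allpairs size_iota mulnC leq_mul2l size_words orbT.
apply: (@leq_trans #|` [fset z in ball_cover x n]%fset|); last first.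
  by rewrite card_fseq size_undup.
apply: fsubset_leq_card; apply/fsubsetP => y; rewrite in_fset_set; last first.
  by apply: (sub_finite_set (B := [set` ball_cover x n])) => // z; exact: ball_coverP.
by rewrite inE in_fset /= => /ball_coverP.
Qed.

Lemma ball_card_ge (x : G) n : (d.-1 ^ n <= #|` fset_set (graph_ball x n)|)%N.
Proof.
pose M : seq G := [seq (y : regular_tree d, x.2) | y <- offspring n x.1].
have uM : uniq M by rewrite map_inj_uniq ?offspring_uniq // => a b [].
apply: (@leq_trans (size M)).
  rewrite size_map; case: (boolP (nilp (val x.1))) => [|/size_offspring ->//].
  move=> /nilP x0; have -> : x.1 = tree_root d by apply: val_inj.
  case: n {M uM} => [|n] //; rewrite size_offspring_root expnS leq_mul2r.
  by rewrite leq_pred orbT.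
apply: (@leq_trans #|` [fset z in M]%fset|); first by rewrite card_fseq undup_id.
apply: fsubset_leq_card; apply/fsubsetP => y; rewrite in_fset_set; last first.
  by apply: (sub_finite_set (B := [set` ball_cover x n])) => // z; exact: ball_coverP.
rewrite in_fset /= => /mapP[z /offspring_ball[q pq [lq sq]] ->]; rewrite inE.
exists [seq (y : regular_tree d, x.2) | y <- q].
  rewrite [x in path _ x]surjective_pairing path_map.
  by apply: sub_path pq => a b ab; apply/orP; left; rewrite /= eqxx andbT.
by rewrite size_map -lq [x in last x]surjective_pairing last_map.
Qed.

Lemma powR_root (a : R) n : 0 <= a -> (0 < n)%N -> (a ^+ n) `^ (n%:R)^-1 = a.
Proof.
move=> a0 n0; rewrite -powR_mulrn // -powRrM mulfV ?powRr1 //.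
by rewrite pnatr_eq0 -lt0n.
Qed.

Lemma bernoulli_inequality n (t : R) : 0 <= t -> 1 + n%:R * t <= (1 + t) ^+ n.
Proof.
move=> t0; elim: n => [|n IH]; first by rewrite mul0r addr0.
have nt : 0 <= n%:R * t * t by rewrite !mulr_ge0.
rewrite exprS; apply: le_trans (ler_wpM2l (addr_ge0 ler01 t0) IH).
by rewrite -natr1 -subr_ge0 (_ : _ - _ = n%:R * t * t) //; ring.
Qed.

(** Cubing [n t <= (1 + t) ^ n] gains one degree over the quadratic left-hand side. *)
Lemma polynomial_le_expn (t : R) : 0 < t ->
  \forall n \near \oo, ((n + n).+1 * (n.+1 * d))%:R <= (1 + t) ^+ (3 * n).
Proof.
move=> t0; have t30 : 0 < t ^+ 3 by rewrite exprn_gt0.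
near=> n.
have n1 : (1 <= n)%N by near: n; exists 1%N.
have nbig : (8 * d)%:R / t ^+ 3 <= n%:R :> R by near: n; exact: nbhs_infty_ger.
apply: (@le_trans _ _ ((n%:R * t) ^+ 3)); last first.
  rewrite mulnC exprM; apply: lerXn2r; rewrite ?nnegrE; first by rewrite mulr_ge0 // ltW.
    by rewrite exprn_ge0 // addr_ge0 // ltW.
  by apply: le_trans (bernoulli_inequality n (ltW t0)); rewrite lerDr.
rewrite ler_pdivrMr // in nbig.
apply: (@le_trans _ _ (n%:R ^+ 2 * (8 * d)%:R)).
  rewrite -natrX -natrM ler_nat; nia.
have -> : (n%:R * t) ^+ 3 = n%:R ^+ 2 * (n%:R * t ^+ 3) by ring.
by rewrite ler_wpM2l // exprn_ge0.
Unshelve. all: by end_near.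
Qed.

(** Between [(d - 1) ^ n] and a quadratic multiple of it, the cardinality of the
    ball has [n]-th root tending to [d - 1]. *)
Lemma growth_rate_tree_line (x : G) : growth_rate R x = d%:R - 1.
Proof.
have dE : d%:R - 1 = (d.-1)%:R :> R by rewrite -[in LHS](prednK (n := d)) ?(ltn_trans _ d3) // -natr1 addrK.
rewrite dE /growth_rate; apply: (cvg_limn_inf_sup _).1; apply/cvgrPdist_le => e e0.
set D : R := (d.-1)%:R; have D2 : 2 <= D by rewrite ler_nat; lia.
have D0 : 0 <= D by lra.
(* for [t <= 1] the cube of [1 + t] is at most [1 + 7 t] *)
pose t := Num.min 1 (e / (7 * D)).
have t0 : 0 < t by rewrite lt_min ltr01 divr_gt0 //; lra.
have t1 : t <= 1 by rewrite ge_min lexx.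
have te : 7 * D * t <= e by rewrite mulrC -ler_pdivlMr ?ge_min ?lexx ?orbT //; lra.
near=> n.
have n1 : (1 <= n)%N by near: n; exists 1%N.
have poly : ((n + n).+1 * (n.+1 * d))%:R <= (1 + t) ^+ (3 * n).
  by near: n; exact: polynomial_le_expn.
set u := _ `^ _.
have lo : D <= u.
  rewrite -[leLHS](powR_root D0 n1).
  apply: ge0_ler_powR; rewrite ?nnegrE ?invr_ge0 ?exprn_ge0 //.
  by rewrite -natrX ler_nat ball_card_ge.
have hi : u <= (1 + t) ^+ 3 * D.
  have tD0 : 0 <= (1 + t) ^+ 3 * D by rewrite mulr_ge0 ?exprn_ge0 //; lra.
  rewrite -[leRHS](powR_root tD0 n1).
  apply: ge0_ler_powR; rewrite ?nnegrE ?invr_ge0 ?(exprn_ge0 _ tD0) //.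
  rewrite exprMn -exprM.
  apply: le_trans (_ : ((n + n).+1 * (n.+1 * d))%:R * D ^+ n <= _); last first.
    by apply: ler_wpM2r => //; rewrite exprn_ge0 //; lra.
  by rewrite -natrX -natrM ler_nat -!mulnA; exact: ball_card_le.
have : (1 + t) ^+ 3 <= 1 + 7 * t.
  have h : 0 <= t * (1 - t) by apply: mulr_ge0; rewrite ?subr_ge0 // ltW.
  have h2 : 0 <= t * (t * (1 - t)) by rewrite mulr_ge0 // ltW.
  rewrite -subr_ge0 (_ : _ - _ = 4 * (t * (1 - t)) + t * (t * (1 - t))); last by ring.
  lra.
move=> t7; rewrite ler_norml; apply/andP; split; last by lra.
have : (1 + t) ^+ 3 * D <= (1 + 7 * t) * D by apply: ler_wpM2r => //; lra.
have -> : (1 + 7 * t) * D = D + 7 * D * t by ring.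
by lra.
Unshelve. all: by end_near.
Qed.

End Growth.

(** * The critical point *)

Lemma avg_zero (R : realFieldType) (E : eqType) (s : seq E) (f : (E -> bool) -> R) w :
  avg 0 s f w = f (fun e => w e && (e \notin s)).
Proof.
elim: s w => [|e s IH] w /=; first by congr f; apply/funext => e; rewrite andbT.
rewrite /avg1 mul0r add0r subr0 mul1r IH; congr f; apply/funext => e'.
by rewrite /upd inE negb_or; case: eqVneq; rewrite ?andbF.
Qed.

Section Criticality.
Variables (R : realType) (d : nat).
Hypothesis d3 : (3 <= d)%N.
Local Notation G := (tree_line d).
Local Notation at0 u := ((u : regular_tree d, 0 : line) : tree_line d).

(** The length [K] of the chain is free, and each of its copies multiplies the
    expected number of connected descendants by [tau * (d - 1) ^ n > 1]; for large
    [K] this beats the constant cost [b] of the two straight ends. *)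
Lemma infinite_cluster_of_connection (q : R) (P : probability (config G) R)
    (v : word d) (s : seq (edge G)) :
  bernoulli_percolation q P -> 0 < q <= 1 ->
  (forall w, (d.-1%:R ^+ size (val v))^-1 < prob_of q s (joined_in s (at0 (tree_root d)) (at0 v)) w) ->
  {ae P, forall w, has_infinite_cluster w}.
Proof.
move=> hP /andP[q0 q1] big.
set D : R := d.-1%:R; set n := size (val v).
have q01 : 0 <= q <= 1 by rewrite ltW.
have D0 : 0 < D by rewrite ltr0n; case: (d) d3 => [|[|]].
pose tau := prob_of q s (joined_in s (at0 (tree_root d)) (at0 v)) (fun=> false).
have [r lowr] := low_exists s.
have conn : connected_with_prob q (low r) (at0 (tree_root d)) (at0 v) tau.
  exists s => // w; rewrite le_eqVlt; apply/orP; left; apply/eqP.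
  exact/avg_const/indicator_depends/joined_in_depends.
have x1 : 1 < tau * D ^+ n by have := big (fun=> false); rewrite -ltr_pdivrMr ?exprn_gt0 // div1r.
have tau0 : 0 <= tau by rewrite -(pmulr_lge0 _ (exprn_gt0 n D0)); apply: le_trans (ltW x1).
pose M := r.+1; pose b := (q * D) ^+ (M + M).
have b0 : 0 < b by rewrite exprn_gt0 // mulr_gt0.
have [K hK] : exists K, 2 / b <= (tau * D ^+ n) ^+ K.
  have y0 : 0 < tau * D ^+ n - 1 by rewrite subr_gt0.
  have [K _ /(_ K (leqnn K)) hK] := nbhs_infty_ger (2 / b / (tau * D ^+ n - 1)).
  exists K; rewrite /= ler_pdivrMr // in hK; apply: le_trans hK _.
  have := bernoulli_inequality K (ltW y0); rewrite [1 + (_ - 1)]addrC subrK.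
  by apply: le_trans; rewrite lerDr.
set N := (M + K * n + M)%N.
have sc u y : y \in offspring N u ->
    connected_with_prob q (slab u N) (at0 u) (at0 y) (q ^+ M * (tau ^+ K * q ^+ M)).
  by rewrite offspringP => /andP[uy /eqP sy]; apply: conn_slab conn uy sy.
have large : 2 <= q ^+ M * (tau ^+ K * q ^+ M) * (d.-1 ^ N)%:R.
  rewrite ler_pdivrMr // in hK; apply: le_trans hK _.
  have -> : (d.-1 ^ N)%:R = D ^+ M * (D ^+ n) ^+ K * D ^+ M by rewrite natrX !exprD mulnC exprM.
  by rewrite /b exprD !exprMn le_eqVlt; apply/orP; left; apply/eqP; ring.
have c0 : 0 < ((d.-1 ^ N)%:R : R)^-1 by rewrite invr_gt0; exact: branch_gt0.
apply: (infinite_cluster_ae hP q01 d3 c0) => m u u0.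
have N0 : (0 < N)%N by rewrite /N /M addSn.
exact: (reach_with_prob q01 d3 N0 sc large m u0).
Qed.

(** The opposite strict inequality would be witnessed by finitely many edges. Its
    probability is continuous in the parameter, so that it would persist at some
    [q < p_c], and there would be an infinite cluster at [q]. *)
Lemma connection_at_criticality (P : R -> probability (config G) R)
    (hP : forall p : R, 0 <= p <= 1 -> bernoulli_percolation p (P p)) (v : word d) :
  (0 < size (val v))%N ->
  fine (P (critical_probability P) [set w | joined w (at0 (tree_root d)) (at0 v)]) <=
    (d.-1%:R ^+ size (val v))^-1.
Proof.
move=> v0; rewrite leNgt; apply/negP => big.
set pc := critical_probability P in big *.
pose S := [set p : R | 0 <= p <= 1 /\ {ae P p, forall w, has_infinite_cluster w}].
have lbS : lbound S 0 by move=> p [/andP[]].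
have pc01 : 0 <= pc <= 1.
  have [S0|/set0P[p Sp]] := eqVneq S set0.
    by rewrite /pc /critical_probability -/S S0 inf0 lexx ler01.
  apply/andP; split; first by apply: lb_le_inf; [exists p|].
  by apply: le_trans (ge_inf _ Sp) _; [exists 0|case: Sp => /andP[]].
have [s big_s] := joined_approx (hP pc pc01) big.
pose f (q : R) : R := prob_of q s (joined_in s (at0 (tree_root d)) (at0 v)) (fun=> false).
have fpc : (d.-1%:R ^+ size (val v))^-1 < f pc by exact: big_s.
(* at parameter 0 no edge is open, so that the connection is impossible *)
have [pc0|pc0] := eqVneq pc 0.
  move: fpc; rewrite pc0 /f /prob_of avg_zero asboolF /=.
    by rewrite ltNge invr_ge0 exprn_ge0.
  move=> [[|z q] /=]; first by move=> _ [rv]; rewrite -rv in v0.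
  by move=> /andP[/asboolP[e _]].
have pcgt0 : 0 < pc by rewrite lt_neqAle eq_sym pc0; case/andP: pc01.
have fnear : \forall q \near pc, (d.-1%:R ^+ size (val v))^-1 < f q.
  have fc : f q @[q --> pc] --> f pc by exact: avg_continuous.
  exact: (cvgr_gt _ fc) fpc.
have : \forall q \near pc^'-, [/\ 0 < q, q < pc & (d.-1%:R ^+ size (val v))^-1 < f q].
  near=> q; split; [by near: q; exact: nbhs_left_gt| by near: q; exact: nbhs_left_lt|].
  by near: q; apply: filterS fnear => q hq _.
move=> /filter_ex[q [q0 qpc fq]].
have q1 : q <= 1 by apply: le_trans (ltW qpc) _; case/andP: pc01.
have q01 : 0 <= q <= 1 by rewrite ltW.
suff Sq : S q by have := ge_inf (ex_intro _ 0 lbS) Sq; rewrite leNgt qpc.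
split=> //; apply: (infinite_cluster_of_connection (v := v) (s := s) (hP q q01)).
  by rewrite q0.
move=> w; apply: lt_le_trans fq _; rewrite le_eqVlt; apply/orP; left; apply/eqP.
exact/avg_const/indicator_depends/joined_in_depends.
Unshelve. all: by end_near.
Qed.

End Criticality.

Theorem lemma1p3 (R : realType) (d : nat) (hd : (3 <= d)%N)
    (P : R -> probability (config (tree_line d)) R)
    (hP : forall p : R, 0 <= p <= 1 -> bernoulli_percolation p (P p))
    (v : nat -> regular_tree d)
    (hv : forall n : nat, at_distance (tree_root d) (v n) n)
    (x : tree_line d) :
  alpha (P (critical_probability P)) v <= (growth_rate R x)^-1 /\
  (growth_rate R x)^-1 = 1 / (d%:R - 1).
Proof.
rewrite growth_rate_tree_line // div1r; split => //.
have dE : d%:R - 1 = (d.-1)%:R :> R.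
  by rewrite -[in LHS](prednK (n := d)) ?(ltn_trans _ hd) // -natr1 addrK.
rewrite dE /alpha; set u := (u in limn u).
(* the default value of a divergent sequence is 0 *)
have [cu|/dvgP ->] := pselect (cvgn u); last by rewrite invr_ge0.
apply: limr_le => //; near=> n.
have n1 : (1 <= n)%N by near: n; exists 1%N.
have vn : size (val (v n)) = n := at_distance_root (hv n).
have := connection_at_criticality hd hP (v := v n); rewrite vn => /(_ n1) h.
rewrite -[leRHS](powR_root _ n1) ?invr_ge0 //.
apply: ge0_ler_powR; rewrite ?nnegrE ?invr_ge0 ?exprn_ge0 ?invr_ge0 //.
  exact: fine_ge0.
by rewrite exprVn.
Unshelve. all: by end_near.
Qed.
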